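(* Let $H\colon\Omega\to S(m)$ be given, with repeated eigenvalues $\lambda_1(x)\le\cdots\le\lambda_m(x)$, eigenprojections $P_i(x)$ and multiplicities $d_i(x)=\operatorname{tr}P_i(x)$, so that $H(x)=\sum_{i=1}^m\frac{\lambda_i(x)}{d_i(x)}P_i(x)$. The following hold for every $j\in\{1,\dots,m\}$. (A) Zero'th order properties. Assume that $H\in C(\Omega,S(m))$. (i) $\lambda_j$ is continuous in $\Omega$. (ii) If $H\in C^\alpha(\Omega,S(m))$ for some $0<\alpha\le1$, then $\lambda_j\in C^\alpha(\Omega)$ with the same Hölder/Lipschitz constant as $H$. (B) First order properties. Assume that $H\in C^1(\Omega,S(m))$. (i) If $P_j$ has constant dimension $\operatorname{tr}P_j(x)=d_j$ in $\Omega$, then $\lambda_j$ has directional derivatives $\mathrm{D}_e\lambda_j$ satisfying \[\mathrm{D}_e\lambda_j(x)\cdot P_j(x)=P_j(x)\,\mathrm{D}_eH(x)\,P_j(x)\] for all $x\in\Omega$ in every direction $e\in\mathbb{R}^n$. In particular, \[\mathrm{D}_e\lambda_j(x)=\frac1{d_j}\operatorname{tr}\big(P_j(x)\,\mathrm{D}_eH(x)\big)\] and \[\mathrm{D}_e\lambda_j(x)=\xi^T\mathrm{D}_eH(x)\xi=\xi^T\nabla_\xi H(x)e\] for any $\xi\in P_j(x)(\mathbb{R}^m)\cap\mathbb{S}^{m-1}$. (ii) Suppose that one (and therefore all) of the following equivalent conditions holds: (a) $\lambda_j$ is $C^1$ and $P_j$ has constant dimension in $\Omega$; (b) $\lambda_j$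 is differentiable and $P_j$ has constant dimension in $\Omega$; (c) $P_j$ is differentiable in $\Omega$; (d) $P_j$ is continuous in $\Omega$. Then, with $d_j$ denoting the constant value of $\operatorname{tr}P_j$, for all $x\in\Omega$, \[|\nabla\lambda_j(x)|\le\frac1{\sqrt{d_j}}\max_{e\in\mathbb{S}^{n-1}}\|\mathrm{D}_eH(x)\|,\] and \[\nabla\lambda_j(x)=\xi^T\nabla_\xi H(x)\] for any $\xi\in P_j(x)(\mathbb{R}^m)\cap\mathbb{S}^{m-1}$. Alternatively, \[\nabla\lambda_j(x)e=\mathrm{D}_e\lambda_j(x)=\frac1{d_j}\operatorname{tr}\big(P_j(x)\,\mathrm{D}_eH(x)\big)\] for every $e\in\mathbb{R}^n$. (C) Second order properties. Assume that $H\in C^2(\Omega,S(m))$. (i) Let $a\in\mathbb{R}^n$. If $P_j$ has constant dimension $\operatorname{tr}P_j(x)=d_j$ in $\Omega$, then $\mathrm{D}_a\lambda_j$ exists and has directional derivatives $\mathrm{D}_b\mathrm{D}_a\lambda_j$ satisfying \[\mathrm{D}_b\mathrm{D}_a\lambda_j(x)\cdot P_j(x)=P_j(x)\Big(\mathrm{D}_b\mathrm{D}_aH(x)+\mathrm{D}_aH(x)A_j(x)\mathrm{D}_bH(x)+\mathrm{D}_bH(x)A_j(x)\mathrm{D}_aH(x)\Big)P_j(x)\] for all $x\in\Omega$ in every direction $b\in\mathbb{R}^n$. In particular, \[\mathrm{D}_b\mathrm{D}_a\lambda_j(x)=\frac1{d_j}\operatorname{tr}\Big(P_j(x)\big[\mathrm{D}_b\mathrm{D}_aH(x)+2\,\mathrm{D}_aH(x)A_j(x)\mathrm{D}_bH(x)\big]\Big)\]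 and \begin{align*} \mathrm{D}_b\mathrm{D}_a\lambda_j(x)&=\xi^T\Big(\mathrm{D}_b\mathrm{D}_aH(x)+2\,\mathrm{D}_aH(x)A_j(x)\mathrm{D}_bH(x)\Big)\xi\\ &=a^T\Big(\nabla_\xi(\nabla_\xi H)^T(x)+2(\nabla_\xi H(x))^TA_j(x)\nabla_\xi H(x)\Big)b \end{align*} for any $\xi\in P_j(x)(\mathbb{R}^m)\cap\mathbb{S}^{m-1}$. (ii) Suppose that one (and therefore all) of the conditions (a)-(d) listed in (B)(ii) holds. Then $\nabla\lambda_j$ is differentiable in $\Omega$ with Hessian $\mathcal{H}\lambda_j:=\nabla(\nabla\lambda_j^T)$ given by \[\mathcal{H}\lambda_j(x)=\nabla_\xi(\nabla_\xi H)^T(x)+2(\nabla_\xi H(x))^TA_j(x)\nabla_\xi H(x)\] for all $x\in\Omega$ and any $\xi\in P_j(x)(\mathbb{R}^m)\cap\mathbb{S}^{m-1}$. Alternatively, \[a^T\mathcal{H}\lambda_j(x)b=\mathrm{D}_b\mathrm{D}_a\lambda_j(x)=\frac1{d_j}\operatorname{tr}\Big(P_j(x)\big[\mathrm{D}_b\mathrm{D}_aH(x)+2\,\mathrm{D}_aH(x)A_j(x)\mathrm{D}_bH(x)\big]\Big)\] for every $a,b\in\mathbb{R}^n$.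
   Context: $\Omega\subseteq\mathbb{R}^n$ is a domain (nonempty, open, connected) and $S(m)$ is the space of real symmetric $m\times m$ matrices with norm $\|X\|:=\sqrt{\operatorname{tr}(X^TX)}$; $|y|=\sqrt{y^Ty}$ is the Euclidean norm; $\mathbb{S}^{k-1}$ is the unit sphere of $\mathbb{R}^k$. Eigenvalues are repeated according to multiplicity. The eigenprojection $P_i(x)$ is the symmetric matrix of the orthogonal projection of $\mathbb{R}^m$ onto the full eigenspace $\{\xi: H(x)\xi=\lambda_i(x)\xi\}$ (so $P_i(x)=P_k(x)$ when $\lambda_i(x)=\lambda_k(x)$); its dimension is $\operatorname{tr}P_i(x)=d_i(x)$, and $P_j(x)(\mathbb{R}^m)$ denotes its range, i.e. the eigenspace. Define \[A_j(x) := \sum_{\substack{1\le i\le m\\ \lambda_i(x)\ne\lambda_j(x)}}\frac{P_i(x)/d_i(x)}{\lambda_j(x)-\lambda_i(x)}\in S(m)\] (an empty sum is zero). $H\in C^\alpha(\Omega,S(m))$ with constant $C$ means $\|H(x)-H(y)\|\le C|x-y|^\alpha$ for all $x,y\in\Omega$ (Lipschitz if $\alpha=1$), and similarly for real-valued functions with absolute value. For a (scalar- or matrix-valued) $F$ on $\Omega$, $\mathrm{D}_eF(x):=\lim_{h\to0}\frac{F(x+he)-F(x)}{h}$ (two-sided limit), $e\in\mathbb{R}^n$; $\mathrm{D}_b\mathrm{D}_aF$ is the directional derivative in direction $b$ of $x\mapsto\mathrm{D}_aF(x)$. Gradients $\nabla\lambda_j$ are row vectors, and $\nabla\mathbf{f}$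 is the Jacobian matrix of a vector-valued $\mathbf{f}$. For a differentiable $F\colon\Omega\to\mathbb{R}^{m\times k}$ and $q\in\mathbb{R}^k$, $\nabla_qF(x)\in\mathbb{R}^{m\times n}$ is the Jacobian matrix at $x$ of $y\mapsto F(y)q$, with $q$ held fixed. In particular $\nabla_p(\nabla_qH)^T(x)\in S(n)$ is the Hessian matrix at $x$ of $y\mapsto p^TH(y)q$ for fixed $p,q\in\mathbb{R}^m$. The eigenvectors $\xi$ may depend on $x$, but in expressions such as $\nabla_\xi H(x)$ and $\nabla_\xi(\nabla_\xi H)^T(x)$ the vector $\xi$ is held fixed while differentiating. *)

(* Defs.v *)
From HB Require Import structures.
From mathcomp Require Import all_boot all_order all_algebra.
From mathcomp Require Import all_classical all_reals all_analysis.
Set Implicit Arguments.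
Unset Strict Implicit.
Unset Printing Implicit Defensive.
Import Order.TTheory GRing.Theory Num.Theory.
Import numFieldNormedType.Exports.
Local Open Scope ring_scope.
Local Open Scope classical_set_scope.

(* Points of R^n are column vectors.  Functions "on Omega" are total functions
   on 'cV[R]_n that are only constrained at points of Omega; since Omega is
   open, limits, derivatives and differentials at points of Omega only depend
   on the values taken in Omega.  The library norm of matrices is the max norm,
   which induces the usual topology, hence the usual notions of continuity and
   differentiability; the norms that occur in estimates are defined here. *)

Section Norms.
Context {R : realType}.

Definition frob {p q : nat} (X : 'M[R]_(p, q)) : R := Num.sqrt (\tr (X^T *m X)).

Definition enorm {k : nat} (y : 'cV[R]_k) : R := Num.sqrt ((y^T *m y) 0 0).

Definition usphere (k : nat) : set 'cV[R]_k := [set y | enorm y = 1].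

Definition is_maximum (A : set R) (M : R) : Prop := A M /\ ubound A M.

End Norms.

Arguments usphere {R} k _.

Section Regularity.
Context {R : realType} {n : nat}.
Implicit Types Omega : set 'cV[R]_n.

Definition is_domain Omega : Prop :=
  [/\ Omega !=set0, open Omega & connected Omega].

Definition holder_on {W : zmodType} (nrm : W -> R) Omega (alpha C : R)
    (F : 'cV[R]_n -> W) : Prop :=
  forall x y, Omega x -> Omega y ->
    nrm (F x - F y) <= C * enorm (x - y) `^ alpha.

(* Continuity of the derivative of order k is expressed by continuity of all
   the iterated directional derivatives of order k, which in finite dimension
   is the same as continuity in operator norm. *)
Fixpoint Ck_on {W : normedModType R} Omega (k : nat) (F : 'cV[R]_n -> W)
    : Prop :=
  if k is k'.+1 then
    (forall x, Omega x -> differentiable F x) /\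
    (forall e : 'cV[R]_n, Ck_on Omega k' ('D_e F))
  else {within Omega, continuous F}.

(* The library's jacobian acts on row vectors on the right; this one is its
   counterpart for column vectors, i.e. 'd F x v = jac F x *m v. *)
Definition jac {k : nat} (F : 'cV[R]_n -> 'cV[R]_k) (x : 'cV[R]_n)
    : 'M[R]_(k, n) :=
  \matrix_(i, j) ('d F x (delta_mx j 0) : 'cV[R]_k) i 0.

Definition grad (f : 'cV[R]_n -> R) (x : 'cV[R]_n) : 'rV[R]_n :=
  \row_j ('d f x (delta_mx j 0) : R).

Definition hessian (f : 'cV[R]_n -> R) (x : 'cV[R]_n) : 'M[R]_n :=
  jac (fun y => (grad f y)^T) x.

Definition nabla {m k : nat} (q : 'cV[R]_k) (F : 'cV[R]_n -> 'M[R]_(m, k))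
    (x : 'cV[R]_n) : 'M[R]_(m, n) :=
  jac (fun y => F y *m q) x.

End Regularity.

Section Spectral.
Context {R : realType} {m : nat}.

Definition repeated_eigenvalues (X : 'M[R]_m) (l : 'I_m -> R) : Prop :=
  (forall i k : 'I_m, (i <= k)%N -> l i <= l k) /\
  char_poly X = \prod_(i < m) ('X - (l i)%:P).

Definition eigensp (X : 'M[R]_m) (a : R) : set 'cV[R]_m :=
  [set xi | X *m xi = a *: xi].

Definition is_orthproj (E : set 'cV[R]_m) (P : 'M[R]_m) : Prop :=
  forall v : 'cV[R]_m,
    E (P *m v) /\ forall w, E w -> w^T *m (v - P *m v) = 0.

Definition unit_eigvec (P : 'M[R]_m) : set 'cV[R]_m :=
  range (mulmx P) `&` usphere m.

Context {n : nat}.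

Definition Amx (lam : 'I_m -> 'cV[R]_n -> R) (P : 'I_m -> 'cV[R]_n -> 'M[R]_m)
    (j : 'I_m) (x : 'cV[R]_n) : 'M[R]_m :=
  \sum_(i < m | lam i x != lam j x)
    (lam j x - lam i x)^-1 *: ((\tr (P i x))^-1 *: P i x).

Implicit Types (Omega : set 'cV[R]_n) (l : 'cV[R]_n -> R)
  (P : 'cV[R]_n -> 'M[R]_m).

Definition const_dim Omega P (d : R) : Prop :=
  forall x, Omega x -> \tr (P x) = d.

Definition cond_a Omega l P : Prop :=
  Ck_on Omega 1 l /\ exists d, const_dim Omega P d.

Definition cond_b Omega l P : Prop :=
  (forall x, Omega x -> differentiable l x) /\ exists d, const_dim Omega P d.

Definition cond_c Omega P : Prop := forall x, Omega x -> differentiable P x.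

Definition cond_d Omega P : Prop := {within Omega, continuous P}.

Definition some_cond Omega l P : Prop :=
  [\/ cond_a Omega l P, cond_b Omega l P, cond_c Omega P | cond_d Omega P].

End Spectral.

(* Main.v *)
Require Import Defs.
From HB Require Import structures.
From mathcomp Require Import all_boot all_order all_algebra.
From mathcomp Require Import all_classical all_reals all_analysis.
From mathcomp Require Import ring.
Set Implicit Arguments.
Unset Strict Implicit.
Unset Printing Implicit Defensive.
Import Order.TTheory GRing.Theory Num.Theory.
Import numFieldNormedType.Exports.
Local Open Scope ring_scope.
Local Open Scope classical_set_scope.

(* Let [P] project onto an eigenspace of [X] with eigenvalue [a] and let [S] be
   the reduced resolvent, [S *m (a - X) = 1 - P] and [S *m P = 0]; for [P_j] it
   is [A_j].  Two such data [(X, a, P, S)], [(X0, a0, P0, S0)] satisfy, with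
   [D := (X - X0) - (a - a0)], the exact identities
     P - P0 = S0 D P + P0 D S    and    (a - a0) tr (P0 P) = tr (P0 (X - X0) P).
   Eigenvalues are continuous by Weyl's inequality.  If moreover [P] and [P0] have
   the same rank then [|P - P0|^2 = 2 tr (S0 D P)], so [P_j] is continuous without
   any separation of eigenvalue clusters, and so is [S = (a - X + P)^-1 - P].  The
   identities then exhibit [lambda_j] and [P_j] as differentiable in
   Carathéodory's sense, with [P' = S H' P + P H' S]; second derivatives follow
   by differentiating [tr (P H') / d]. *)

(** * Frobenius norm and the spectral theorem *)

(** The obstacle is that the resolvent [S] has no a priori bound near the base point: other
    eigenvalues might approach the chosen one. Equal rank removes [S] from the first estimate,
    because both halves of [|P - P0|^2] can then be charged to [(1 - P0) P = S0 D P], which contains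
    only the resolvent at the base point. Once [P] is continuous, [S] is controlled through
    [a - X + P], which is invertible at the base point. In both exact identities a factor known only
    to be continuous always multiplies one that vanishes at the base point, so no derivative of [P]
    or [S] has to be assumed in order to differentiate. The trace formulas follow at once; the
    sharper matrix formulas come from differentiating [H P = lambda P], and then its first-order
    consequence, and compressing with [P]. *)

Section Frobenius.
Context {R : realType}.

Lemma mxtrace_trmul p q (A B : 'M[R]_(p, q)) :
  \tr (A^T *m B) = \sum_i \sum_j A i j * B i j.
Proof.
rewrite exchange_big; apply: eq_bigr => j _; rewrite mxE.
by apply: eq_bigr => i _; rewrite mxE.
Qed.

Lemma mxtrace_trmul_ge0 p q (A : 'M[R]_(p, q)) : 0 <= \tr (A^T *m A).
Proof.
by rewrite mxtrace_trmul; do 2![apply: sumr_ge0 => ? _]; rewrite -expr2 sqr_ge0.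
Qed.

Lemma mxtrace_trmulC p q (A B : 'M[R]_(p, q)) :
  \tr (A^T *m B) = \tr (B^T *m A).
Proof. by rewrite -mxtrace_tr trmx_mul trmxK. Qed.

Lemma mxtrace_trmul_eq0 p q (A : 'M[R]_(p, q)) : \tr (A^T *m A) = 0 -> A = 0.
Proof.
have sq0 i j : 0 <= A i j * A i j by rewrite -expr2 sqr_ge0.
rewrite mxtrace_trmul => /psumr_eq0P A0; apply/matrixP => i j; rewrite mxE.
have /psumr_eq0P/(_ j isT)/eqP := A0 (fun i _ => sumr_ge0 _ (fun j _ => sq0 i j)) i isT.
by rewrite mulf_eq0 orbb => /(_ _)/eqP; apply.
Qed.

Lemma frob_sqr p q (A : 'M[R]_(p, q)) : frob A ^+ 2 = \tr (A^T *m A).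
Proof. by rewrite sqr_sqrtr ?mxtrace_trmul_ge0. Qed.

Lemma frob_ge0 p q (A : 'M[R]_(p, q)) : 0 <= frob A.
Proof. exact: sqrtr_ge0. Qed.

Lemma enormE k (y : 'cV[R]_k) : enorm y = frob y.
Proof. by rewrite /enorm /frob /mxtrace big_ord1. Qed.

Lemma frob_CS p q (A B : 'M[R]_(p, q)) : `|\tr (A^T *m B)| <= frob A * frob B.
Proof.
rewrite -(@ler_pXn2r _ 2) ?nnegrE ?mulr_ge0 ?frob_ge0 //.
rewrite exprMn !frob_sqr real_normK ?num_real //.
set a := \tr (A^T *m A); set b := \tr _; set c := \tr (B^T *m B).
(* The square norm of [a B - b A] is [a (a c - b^2)]. Dividing by [a] needs [a > 0]; for [a = 0] the
   matrix [A] vanishes, and so does [b]. *)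
have := mxtrace_trmul_ge0 (a *: B - b *: A).
have -> : (a *: B - b *: A)^T = a *: B^T - b *: A^T by rewrite linearB !linearZ.
rewrite mulmxBl !mulmxBr -!scalemxAl -!scalemxAr 3!raddfB /= !mxtraceZ.
rewrite (mxtrace_trmulC B A) -/a -/b -/c => h.
have [a0|a0] := ltP 0 a.
  rewrite -subr_ge0 -(pmulr_rge0 _ a0); apply: le_trans h _.
  by rewrite le_eqVlt; apply/orP; left; apply/eqP; ring.
have /mxtrace_trmul_eq0 A0 : \tr (A^T *m A) = 0.
  by apply/eqP; rewrite eq_le a0 mxtrace_trmul_ge0.
by rewrite /b /a A0 trmx0 !mul0mx linear0 expr0n mul0r.
Qed.

Lemma le_entry_frob p q (A : 'M[R]_(p, q)) i j : `|A i j| <= frob A.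
Proof.
rewrite -(@ler_pXn2r _ 2) ?nnegrE ?frob_ge0 // frob_sqr real_normK ?num_real //.
rewrite mxtrace_trmul (bigD1 i) //= (bigD1 j) //= -addrA expr2 lerDl addr_ge0 //.
  by apply: sumr_ge0 => ? _; rewrite -expr2 sqr_ge0.
by do 2![apply: sumr_ge0 => ? _]; rewrite -expr2 sqr_ge0.
Qed.

(** Cauchy-Schwarz for the trace pairing of [D] with the rank-one matrix [v v^T], whose Frobenius
    norm is [|v|^2]. *)
Lemma quad_le_frob k (v : 'cV[R]_k) (D : 'M[R]_k) :
  (v^T *m D *m v) 0 0 <= frob D * (v^T *m v) 0 0.
Proof.
have tr1 (A : 'M[R]_1) : A 0 0 = \tr A by rewrite /mxtrace big_ord1.
rewrite !tr1 mxtrace_mulC mulmxA; set W := v *m v^T.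
have WT : W^T = W by rewrite trmx_mul trmxK.
have -> : \tr (v^T *m v) = frob W.
  have vv : v^T *m v = (\tr (v^T *m v))%:M by rewrite -tr1 -mx11_scalar.
  rewrite /frob WT -[W *m W]/(v *m v^T *m (v *m v^T)) mulmxA -[_ *m v^T *m v]mulmxA.
  rewrite {2}vv mul_mx_scalar -scalemxAl mxtraceZ -/W -[\tr W]mxtrace_mulC.
  by rewrite -expr2 sqrtr_sqr ger0_norm // mxtrace_trmul_ge0.
rewrite mulrC -[in leLHS]WT; apply: le_trans (frob_CS _ _).
exact: ler_norm.
Qed.

End Frobenius.

(** * The spectral theorem for real symmetric matrices *)

Section Spectral.
Context {R : realType}.

Lemma char_poly_orthogonal k (U X : 'M[R]_k) :
  U^T *m U = 1%:M -> char_poly (U^T *m X *m U) = char_poly X.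
Proof.
move=> UU; rewrite /char_poly.
have -> : char_poly_mx (U^T *m X *m U) =
    map_mx polyC U^T *m char_poly_mx X *m map_mx polyC U.
  rewrite /char_poly_mx mulmxBr mulmxBl -!map_mxM; congr (_ - _).
  rewrite mul_mx_scalar -scalemxAl -map_mxM UU map_mx1.
  by rewrite -mul_scalar_mx mulmx1.
by rewrite !det_mulmx mulrAC -det_mulmx -map_mxM UU map_mx1 det1 mul1r.
Qed.

(* The reflection [1 - c *: (w *m w^T)] exchanges [e_0] and [u] when
   [w = u - e_0]; for [w = 0] the division gives [c = 0], hence the identity. *)
Lemma unit_vector_completion k (u : 'cV[R]_k.+1) : (u^T *m u) 0 0 = 1 ->
  exists Q : 'M[R]_k.+1,
    [/\ Q^T = Q, Q *m Q = 1%:M & Q *m delta_mx 0 0 = u].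
Proof.
move=> u1; pose e : 'cV[R]_k.+1 := delta_mx 0 0; pose w := u - e.
pose s := (w^T *m w) 0 0; pose c := 2 / s.
have ss : w^T *m w = s%:M by rewrite [LHS]mx11_scalar.
(* With [W = w w^T] and [W^2 = s W], the square of [1 - c W] is [1 + (c^2 s - 2 c) W], so this
   relation makes the reflection an involution; it also holds for [s = 0], where [c = 0]. *)
have c2 : c * c * s = 2 * c.
  rewrite /c; have [->|s0] := eqVneq s 0; first by rewrite invr0 !mulr0.
  by field.
have ute : u^T *m e = (u 0 0)%:M.
  by rewrite [LHS]mx11_scalar /e -colE !mxE.
have ete : e^T *m e = 1%:M.
  rewrite [LHS]mx11_scalar /e trmx_delta mul_delta_mx; congr (_%:M).
  by rewrite !mxE.
have etu : e^T *m u = (u 0 0)%:M by rewrite -[LHS]trmxK trmx_mul trmxK ute tr_scalar_mx.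
have utu : u^T *m u = 1%:M by rewrite [LHS]mx11_scalar u1.
have sE : s = 2 - 2 * u 0 0.
  have wT : w^T = u^T - e^T by rewrite linearB.
  rewrite /s wT /w mulmxBl !mulmxBr ute ete etu utu !mxE /=; ring.
have wte : w^T *m e = (u 0 0 - 1)%:M.
  have wT : w^T = u^T - e^T by rewrite linearB.
  by rewrite wT mulmxBl ute ete -raddfB.
exists (1%:M - c *: (w *m w^T)); split.
- by rewrite linearB linearZ /= trmx1 trmx_mul trmxK.
- set W := w *m w^T.
  have WW : W *m W = s *: W.
    by rewrite /W mulmxA -[w *m _ *m w]mulmxA ss mul_mx_scalar -scalemxAl.
  rewrite mulmxBl mul1mx mulmxBr mulmx1 -scalemxAl -scalemxAr WW !scalerA c2.
  by rewrite mulrDl mul1r scalerDl opprB addrK subrK.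
- rewrite mulmxBl mul1mx -/e -scalemxAl -mulmxA wte mul_mx_scalar scalerA.
  (* Since [s = 2 - 2 u_0], the scalar is [-1] unless [s = 0], and then [w] itself is zero. *)
  have -> : c * (u 0 0 - 1) *: w = - w.
    have [s0|s0] := eqVneq s 0.
      have /mxtrace_trmul_eq0 -> : \tr (w^T *m w) = 0.
        by rewrite ss mxtrace_scalar s0.
      by rewrite scaler0 oppr0.
    rewrite -[- w]scaleN1r; congr (_ *: _); rewrite /c sE; field.
    by rewrite -sE.
  by rewrite opprK /w addrC subrK.
Qed.

(** The eigenvector [e_0] determines the first column, and symmetry copies its zeros to the first
    row. *)
Lemma symmetric_block k (Y : 'M[R]_(1 + k)) (a : R) : Y^T = Y ->
  (Y : 'M[R]_k.+1) *m delta_mx 0 0 = a *: delta_mx 0 0 :> 'cV[R]_k.+1 ->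
  Y = block_mx a%:M 0 0 (drsubmx Y).
Proof.
move=> YT /matrixP Ye.
have lsY i : Y i (lshift k 0) = (i == lshift k 0)%:R * a.
  have := Ye i 0; rewrite -colE !mxE eqxx andbT mulrC => <-.
  by congr (Y _ _); apply/val_inj.
have dlY : dlsubmx Y = 0.
  apply/matrixP => i j; rewrite !mxE (ord1 j) lsY.
  by rewrite -val_eqE /= mul0r.
have ulY : ulsubmx Y = a%:M.
  by apply/matrixP => i j; rewrite !mxE !ord1 lsY !eqxx mul1r mulr1n.
have urY : ursubmx Y = 0 by rewrite -[LHS]trmxK trmx_ursub YT dlY trmx0.
by rewrite -ulY -urY -[in X in block_mx _ _ X _]dlY submxK.
Qed.

Lemma char_poly_scalar_block k a (Z : 'M[R]_k) :
  char_poly (block_mx a%:M 0 0 Z : 'M[R]_(1 + k)) = ('X - a%:P) * char_poly Z.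
Proof.
rewrite /char_poly char_block_diag_mx det_ublock; congr (_ * _).
by rewrite det_mx11 /char_poly_mx !mxE /= !mulr1n.
Qed.

(** Deflation: a reflection carries [e_0] to a unit eigenvector for [l 0], and the complementary
    block has the remaining factors as characteristic polynomial. The polynomial is given as split
    over the reals, so no complex eigenvalue has to be excluded, and the prescribed enumeration [l]
    is preserved. *)
Lemma symmetric_diagonalization k (X : 'M[R]_k) (l : 'I_k -> R) :
  X^T = X -> char_poly X = \prod_i ('X - (l i)%:P) ->
  exists2 U : 'M[R]_k, U^T *m U = 1%:M & X = U *m diag_mx (\row_i l i) *m U^T.
Proof.
elim: k X l => [|k IH] X l XT pX.
  by exists 1%:M; [rewrite [LHS]flatmx0 [RHS]flatmx0|rewrite [LHS]flatmx0 [RHS]flatmx0].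
have : eigenvalue X (l 0).
  rewrite eigenvalue_root_char pX big_ord_recl /root hornerM hornerXsubC subrr.
  by rewrite mul0r.
move=> /eigenvalueP[v vX v0].
have n0 : frob v^T != 0.
  apply/eqP => n0; move: v0; rewrite -[v]trmxK; apply/negP; rewrite negbK.
  by apply/eqP; rewrite (@mxtrace_trmul_eq0 _ _ _ v^T) ?trmx0 // -frob_sqr n0 expr0n.
pose u := (frob v^T)^-1 *: v^T.
have Xu : X *m u = l 0 *: u.
  rewrite /u -scalemxAr -[X *m _]trmxK trmx_mul trmxK XT vX linearZ /=.
  by rewrite !scalerA mulrC.
have [|Q [QT QQ Qe]] := @unit_vector_completion _ u.
  have -> : (u^T *m u) 0 0 = \tr (u^T *m u) by rewrite /mxtrace big_ord1.
  have uT : u^T = (frob v^T)^-1 *: v^T^T by rewrite linearZ.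
  by rewrite uT /u -scalemxAl -scalemxAr !mxtraceZ -frob_sqr; field.
pose Y := (Q *m X *m Q : 'M[R]_(1 + k)).
have YT : Y^T = Y by rewrite /Y !trmx_mul QT XT mulmxA.
have Ye : (Y : 'M[R]_k.+1) *m delta_mx 0 0 = l 0 *: delta_mx 0 0 :> 'cV[R]_k.+1.
  rewrite /Y -mulmxA Qe -mulmxA Xu -scalemxAr -Qe mulmxA QQ mul1mx //.
pose Z := drsubmx Y; have YE := symmetric_block YT Ye.
have QQ' : Q^T *m Q = 1%:M by rewrite QT.
have ZT : Z^T = Z by rewrite /Z trmx_drsub YT.
have pZ : char_poly Z = \prod_i ('X - (l (lift ord0 i))%:P).
  have := char_poly_orthogonal X QQ'; rewrite QT -/Y YE char_poly_scalar_block.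
  by rewrite pX big_ord_recl => /mulfI; apply; rewrite polyXsubC_eq0.
have [V VV ZE] := IH Z _ ZT pZ.
pose W : 'M[R]_(1 + k) := block_mx 1%:M 0 0 V.
have WW : W^T *m W = 1%:M.
  rewrite tr_block_mx mulmx_block trmx1 !trmx0 !mulmx0 !mul0mx addr0 add0r mulmx1.
  by rewrite addr0 add0r VV -scalar_mx_block.
exists (Q *m W : 'M[R]_k.+1); first by rewrite trmx_mul QT mulmxA -(mulmxA W^T) QQ mulmx1.
have dE : diag_mx (\row_i l i) =
    block_mx (l 0)%:M 0 0 (diag_mx (\row_i l (lift ord0 i))) :> 'M[R]_(1 + k).
  apply/matrixP => i j; rewrite -[i]splitK -[j]splitK.
  case: (fintype.split i) => i'; case: (fintype.split j) => j' /=.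
  - rewrite block_mxEul !mxE !ord1 !eqxx !mulr1n; congr l; exact/val_inj.
  - by rewrite block_mxEur !mxE -val_eqE /= ord1.
  - by rewrite block_mxEdl !mxE -val_eqE /= ord1.
  - rewrite block_mxEdr !mxE -val_eqE /= eqSS.
    by congr (l _ *+ _); apply/val_inj.
have YW : Y = W *m (diag_mx (\row_i l i) : 'M[R]_(1 + k)) *m W^T.
  rewrite dE tr_block_mx !mulmx_block trmx1 !trmx0.
  by rewrite !(mulmx0, mul0mx, addr0, add0r, mul1mx, mulmx1) -ZE -YE.
have -> : X = Q *m Y *m Q.
  by rewrite /Y !mulmxA QQ mul1mx -mulmxA QQ mulmx1.
by rewrite YW trmx_mul QT !mulmxA.
Qed.
End Spectral.

(** * Functional calculus and Weyl's inequality *)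

Section FunctionalCalculus.
Context {R : realType} {m : nat}.
Implicit Types (U : 'M[R]_m) (l : 'I_m -> R) (f g : R -> R).

(** This is [f(X)] for [X = U diag(l) U^T]. Eigenprojections and reduced resolvents at a point are
    all of this form with the same [U] and [l], so identities between them reduce to scalar
    identities at each [l i]. *)
Definition fcalc U l f : 'M[R]_m := U *m diag_mx (\row_i f (l i)) *m U^T.

Lemma fcalc_tr U l f : (fcalc U l f)^T = fcalc U l f.
Proof. by rewrite /fcalc !trmx_mul trmxK tr_diag_mx mulmxA. Qed.

Lemma eq_fcalc U l f g : (forall i, f (l i) = g (l i)) -> fcalc U l f = fcalc U l g.
Proof.
move=> fg; congr (_ *m diag_mx _ *m _).
by apply/rowP => i; rewrite !mxE fg.
Qed.

Lemma fcalcZ U l a f : a *: fcalc U l f = fcalc U l (fun t => a * f t).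
Proof.
rewrite /fcalc scalemxAl scalemxAr -linearZ /=; congr (_ *m diag_mx _ *m _).
by apply/rowP => i; rewrite !mxE.
Qed.

Lemma fcalcB U l f g : fcalc U l f - fcalc U l g = fcalc U l (fun t => f t - g t).
Proof.
rewrite /fcalc -mulmxBl -mulmxBr -raddfB /=; congr (_ *m diag_mx _ *m _).
by apply/rowP => i; rewrite !mxE.
Qed.

Lemma fcalc_sum U l (F : 'I_m -> R -> R) :
  \sum_i fcalc U l (F i) = fcalc U l (fun t => \sum_i F i t).
Proof.
rewrite /fcalc -mulmx_suml -mulmx_sumr -raddf_sum /=; congr (_ *m diag_mx _ *m _).
by apply/rowP => i; rewrite summxE !mxE; apply: eq_bigr => k _; rewrite mxE.
Qed.

Context (U : 'M[R]_m) (l : 'I_m -> R) (UU : U^T *m U = 1%:M).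

Lemma fcalcM f g : fcalc U l f *m fcalc U l g = fcalc U l (fun t => f t * g t).
Proof.
rewrite /fcalc !mulmxA -[_ *m U^T *m U]mulmxA UU mulmx1 -[_ *m _ *m diag_mx _]mulmxA.
rewrite mulmx_diag; congr (_ *m diag_mx _ *m _).
by apply/rowP => i; rewrite !mxE.
Qed.

Lemma fcalc_cst a : fcalc U l (cst a) = a%:M.
Proof.
have -> : fcalc U l (cst a) = a *: (U *m U^T).
  rewrite /fcalc scalemxAl; congr (_ *m _); rewrite -mul_mx_scalar.
  by congr (_ *m _); apply/matrixP => i j; rewrite !mxE.
by rewrite (mulmx1C UU) scalemx1.
Qed.

Lemma mxtrace_fcalc f : \tr (fcalc U l f) = \sum_i f (l i).
Proof.
rewrite /fcalc mxtrace_mulC mulmxA UU mul1mx mxtrace_diag.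
by apply: eq_bigr => i _; rewrite mxE.
Qed.

Lemma fcalc_orthproj a :
  is_orthproj (eigensp (fcalc U l id) a) (fcalc U l (fun t => (t == a)%:R)).
Proof.
set X := fcalc U l id; set P := fcalc U l _.
have XP : X *m P = a *: P.
  rewrite fcalcM fcalcZ; apply: eq_fcalc => i.
  by case: eqP => [->|_] //; rewrite !mulr0.
have PE w : eigensp X a w -> P *m w = w.
  rewrite /eigensp /= => Xw; apply/eqP; rewrite eq_sym -subr_eq0 -{1}[w]mul1mx -mulmxBl.
  (* [1 - P] factors through [a - X], hence kills the eigenspace. *)
  have -> : 1%:M - P = fcalc U l (fun t => (a - t)^-1) *m (a%:M - X).
    rewrite -!fcalc_cst !fcalcB fcalcM; apply: eq_fcalc => i /=.
    have [->|ne] := eqVneq (l i) a; first by rewrite !subrr mulr0.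
    by rewrite subr0 mulVf // subr_eq0 eq_sym.
  by rewrite -mulmxA mulmxBl Xw mul_scalar_mx subrr mulmx0.
move=> v; split; first by rewrite /eigensp /= mulmxA XP -scalemxAl.
move=> w /PE Pw; have wP : w^T *m P = w^T by rewrite -[in RHS]Pw trmx_mul fcalc_tr.
by rewrite mulmxBr mulmxA wP subrr.
Qed.

(** The vector [P v - Q v] lies in the eigenspace and, being the difference of [v - Q v] and
    [v - P v], is orthogonal to it. *)
Lemma orthproj_uniq (X : 'M[R]_m) a P Q :
  is_orthproj (eigensp X a) P -> is_orthproj (eigensp X a) Q -> P = Q.
Proof.
move=> hP hQ; suff PQ (v : 'cV[R]_m) : P *m v = Q *m v.
  by apply/matrixP => i j; have /matrixP/(_ i 0) := PQ (delta_mx j 0); rewrite -!colE !mxE.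
have [EP oP] := hP v; have [EQ oQ] := hQ v; apply/eqP; rewrite -subr_eq0; apply/eqP.
have Ew : eigensp X a (P *m v - Q *m v).
  by rewrite /eigensp /= mulmxBr EP EQ scalerBr.
apply: mxtrace_trmul_eq0; set w := P *m v - Q *m v in Ew *.
rewrite -[X in _ *m X](_ : (v - Q *m v) - (v - P *m v) = w).
  by rewrite mulmxBr oP // oQ // subrr mxtrace0.
by rewrite /w opprB addrC addrA subrK.
Qed.

Lemma mxtrace_fcalc_gt0 i : 0 < \tr (fcalc U l (fun t => (t == l i)%:R)).
Proof.
rewrite mxtrace_fcalc (bigD1 i) //= eqxx ltr_pwDl ?ltr01 //.
by apply: sumr_ge0 => k _; exact: ler0n.
Qed.

(** Each eigenspace occurs once for every index carrying its eigenvalue, that is [tr (Q i)] times,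
    which the division compensates. The case [f = id] is the spectral decomposition, and
    [f t = (lambda_j - t)^-1] yields [A_j]. *)
Lemma fcalc_multiplicity_sum (Q : 'I_m -> 'M[R]_m) f :
  (forall i, Q i = fcalc U l (fun t => (t == l i)%:R)) ->
  \sum_i f (l i) *: ((\tr (Q i))^-1 *: Q i) = fcalc U l f.
Proof.
move=> QE; under eq_bigr => i _ do rewrite scalerA {2}QE fcalcZ.
rewrite fcalc_sum; apply: eq_fcalc => k.
transitivity (\sum_i f (l k) / \tr (Q k) * (l i == l k)%:R).
  apply: eq_bigr => i _; rewrite eq_sym.
  by have [lik|] := eqVneq (l i) (l k); rewrite ?mulr0 // !QE lik.
by rewrite -mulr_sumr -(mxtrace_fcalc (fun t => (t == l k)%:R)) -QE divfK // QE gt_eqF // mxtrace_fcalc_gt0.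
Qed.

Lemma quad_fcalc f (v : 'cV[R]_m) :
  (v^T *m fcalc U l f *m v) 0 0 = \sum_i f (l i) * (U^T *m v) i 0 ^+ 2.
Proof.
rewrite /fcalc !mulmxA -[_ *m U^T *m v]mulmxA -[v^T *m U]trmxK trmx_mul trmxK.
rewrite mxE; apply: eq_bigr => i _; rewrite mul_mx_diag [X in X * _]mxE.
by rewrite [X in X * _ * _]mxE [X in _ * X * _]mxE expr2 mulrA [f _ * _]mulrC.
Qed.
End FunctionalCalculus.

(** * Weyl's inequality for ordered eigenvalues *)

Section Weyl.
Context {R : realType} {m : nat}.

Lemma symmetric_fcalc (X : 'M[R]_m) l : X^T = X -> repeated_eigenvalues X l ->
  exists2 U : 'M[R]_m, U^T *m U = 1%:M & X = fcalc U l id.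
Proof. by move=> XT [_ pX]; have [U UU XE] := symmetric_diagonalization XT pX; exists U. Qed.

(* [m - 1] linear conditions on [v] put it both in the span of the first [j + 1]
   eigenvectors of [X] and in that of the last [m - j] eigenvectors of [Y]. *)
Lemma weyl_le (X Y : 'M[R]_m) l k j : X^T = X -> Y^T = Y ->
  repeated_eigenvalues X l -> repeated_eigenvalues Y k ->
  k j - l j <= frob (Y - X).
Proof.
move=> XT YT lX kY.
have [U UU XE] := symmetric_fcalc XT lX; have [V VV YE] := symmetric_fcalc YT kY.
(* Row [j] is left zero, so [M] is singular and its kernel provides [v]; the other [m - 1] rows are
   the orthogonality conditions. *)
pose M : 'M[R]_m := \matrix_(i, c)
  (if (i < j)%N then V^T i c else if (j < i)%N then U^T i c else 0).
have [v v0 Mv] : exists2 v : 'cV[R]_m, v != 0 & M *m v = 0.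
  have : \det M^T == 0.
    rewrite det_tr; apply/det0P; exists (delta_mx 0 j).
      apply/eqP => /matrixP/(_ 0 j)/eqP; rewrite !mxE !eqxx.
      by rewrite oner_eq0.
    by rewrite -rowE; apply/rowP => c; rewrite !mxE ltnn.
  move=> /det0P[v v0 vM]; exists v^T; last by rewrite -[M]trmxK -trmx_mul vM trmx0.
  by apply: contra_neq v0 => /(congr1 trmx); rewrite trmxK trmx0.
have Vv (i : 'I_m) : (i < j)%N -> (V^T *m v) i 0 = 0.
  move=> ij; have /matrixP/(_ i 0) := Mv; rewrite [RHS]mxE => <-.
  by rewrite !mxE; apply: eq_bigr => c _; rewrite !mxE ij.
have Uv (i : 'I_m) : (j < i)%N -> (U^T *m v) i 0 = 0.
  move=> ji; have /matrixP/(_ i 0) := Mv; rewrite [RHS]mxE => <-.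
  by rewrite !mxE; apply: eq_bigr => c _; rewrite !mxE ji ltnNge ltnW.
have nv : 0 < (v^T *m v) 0 0.
  have -> : (v^T *m v) 0 0 = \tr (v^T *m v) by rewrite /mxtrace big_ord1.
  rewrite lt_neqAle mxtrace_trmul_ge0 andbT eq_sym; apply: contra_neq v0.
  exact: mxtrace_trmul_eq0.
rewrite -(ler_pM2r nv); apply: le_trans (quad_le_frob _ _).
have sqE (W : 'M[R]_m) (WW : W^T *m W = 1%:M) : (v^T *m v) 0 0 = \sum_i (W^T *m v) i 0 ^+ 2.
  have := quad_fcalc W l (cst 1) v; rewrite fcalc_cst // mulmx1 => ->.
  by apply: eq_bigr => i _; rewrite mul1r.
have -> : (v^T *m (Y - X) *m v) 0 0 = (v^T *m Y *m v) 0 0 - (v^T *m X *m v) 0 0.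
  by rewrite mulmxBr mulmxBl !mxE.
(* On these spans the ordering gives [v^T Y v >= k j |v|^2] and [v^T X v <= l j |v|^2]. *)
rewrite mulrBl lerB //.
  rewrite YE quad_fcalc (sqE _ VV) mulr_sumr; apply: ler_sum => i _.
  have [ij|ji] := ltnP i j; first by rewrite Vv // expr0n !mulr0.
  by rewrite ler_wpM2r ?sqr_ge0 //; case: kY => mk _; apply: mk.
rewrite XE quad_fcalc (sqE _ UU) mulr_sumr; apply: ler_sum => i _.
have [ji|ij] := ltnP j i; first by rewrite Uv // expr0n !mulr0.
by rewrite ler_wpM2r ?sqr_ge0 //; case: lX => ml _; apply: ml.
Qed.

Lemma weyl (X Y : 'M[R]_m) l k j : X^T = X -> Y^T = Y ->
  repeated_eigenvalues X l -> repeated_eigenvalues Y k ->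
  `|l j - k j| <= frob (X - Y).
Proof.
move=> XT YT lX kY; rewrite ler_norml lerNl opprB; apply/andP; split; last exact: weyl_le.
have -> : frob (X - Y) = frob (Y - X); last exact: weyl_le.
by rewrite -[X - Y]opprB /frob [(- _)^T]linearN /= mulNmx mulmxN opprK.
Qed.

End Weyl.

(** * Limits and derivatives of matrix-valued functions *)

Section MatrixLimits.
Context {R : realType} {T : Type} {F : set_system T} {FF : Filter F}.

Lemma cvg_sumr (W : normedModType R) (I : Type) (r : seq I) (f : I -> T -> W) (a : I -> W) :
  (forall i, f i x @[x --> F] --> a i) ->
  \sum_(i <- r) f i x @[x --> F] --> \sum_(i <- r) a i.
Proof. by move=> h; apply: cvg_big => // -[y z]; exact: add_continuous. Qed.

Lemma cvg_prodr (I : Type) (r : seq I) (f : I -> T -> R) (a : I -> R) :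
  (forall i, f i x @[x --> F] --> a i) ->
  \prod_(i <- r) f i x @[x --> F] --> \prod_(i <- r) a i.
Proof. by move=> h; apply: cvg_big => // -[y z]; exact: mul_continuous. Qed.

Lemma cvg_mxP p q (A : T -> 'M[R]_(p, q)) (L : 'M[R]_(p, q)) :
  A x @[x --> F] --> L <-> forall i j, A x i j @[x --> F] --> L i j.
Proof.
split=> [AL i j|AL].
  by apply: (@cvg_comp _ _ _ A (fun M : 'M[R]_(p, q) => M i j) _ _ _ AL); exact: coord_continuous.
rewrite (matrix_sum_delta L).
under eq_cvg do rewrite (matrix_sum_delta (A _)).
by apply: cvg_sumr => i; apply: cvg_sumr => j; exact: cvgZr_tmp.
Qed.

Lemma cvg_mulmx p q r (A : T -> 'M[R]_(p, q)) (B : T -> 'M[R]_(q, r)) (LA : 'M[R]_(p, q)) (LB : 'M[R]_(q, r)) :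
  A x @[x --> F] --> LA -> B x @[x --> F] --> LB ->
  A x *m B x @[x --> F] --> LA *m LB.
Proof.
move=> /cvg_mxP hA /cvg_mxP hB; apply/cvg_mxP => i j.
under eq_cvg do rewrite mxE.
by rewrite mxE; apply: cvg_sumr => k; exact: cvgM.
Qed.

Lemma cvg_trmx p q (A : T -> 'M[R]_(p, q)) (L : 'M[R]_(p, q)) :
  A x @[x --> F] --> L -> (A x)^T @[x --> F] --> L^T.
Proof.
move=> /cvg_mxP h; apply/cvg_mxP => i j.
by under eq_cvg do rewrite mxE; rewrite mxE; exact: h.
Qed.

Lemma cvg_mxtrace p (A : T -> 'M[R]_p) (L : 'M[R]_p) :
  A x @[x --> F] --> L -> \tr (A x) @[x --> F] --> \tr L.
Proof. by move=> /cvg_mxP h; rewrite /mxtrace; apply: cvg_sumr => i; exact: h. Qed.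

Lemma cvg_scalar_mx p (f : T -> R) (a : R) :
  f x @[x --> F] --> a -> (f x)%:M @[x --> F] --> (a%:M : 'M[R]_p).
Proof.
move=> fa; apply/cvg_mxP => i j; under eq_cvg do rewrite mxE.
rewrite mxE; case: (i == j) => //=; exact: cvg_cst.
Qed.

Lemma cvg_det p (A : T -> 'M[R]_p) (L : 'M[R]_p) :
  A x @[x --> F] --> L -> \det (A x) @[x --> F] --> \det L.
Proof.
move=> /cvg_mxP h; rewrite /determinant; apply: cvg_sumr => s; apply: cvgM; first exact: cvg_cst.
by apply: cvg_prodr => i.
Qed.

(** Cramer's formula is continuous where the determinant is nonzero, and there it agrees with
    [invmx]; the determinant stays nonzero close to the limit. *)
Lemma cvg_invmx p (A : T -> 'M[R]_p) (L : 'M[R]_p) :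
  L \in unitmx -> A x @[x --> F] --> L -> invmx (A x) @[x --> F] --> invmx L.
Proof.
move=> Lu AL; have detA := cvg_det AL.
have L0 : \det L != 0 by rewrite -unitfE -unitmxE.
suff h : (\det (A x))^-1 *: \adj (A x) @[x --> F] --> invmx L.
  apply: cvg_trans h; apply: near_eq_cvg.
  apply: filterS (cvgr_neq0 _ detA L0) => x Ax0.
  by rewrite /invmx unitmxE unitfE Ax0.
rewrite /invmx Lu; apply: cvgZ; first exact: cvgV.
apply/cvg_mxP => i j; under eq_cvg do rewrite mxE; rewrite mxE.
apply: cvgM; first exact: cvg_cst.
apply: cvg_det; apply/cvg_mxP => k k'; under eq_cvg do rewrite !mxE.
by rewrite !mxE; move/cvg_mxP: AL; apply.
Qed.

Lemma cvg_frob0 p q (A : T -> 'M[R]_(p, q)) :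
  frob (A x) @[x --> F] --> 0 -> A x @[x --> F] --> (0 : 'M[R]_(p, q)).
Proof.
move=> h; apply/cvg_mxP => i j; rewrite mxE; apply/cvgr0Pnorm_le => e e0.
move/cvgr0Pnorm_le: h => /(_ e e0); apply: filterS => x.
by rewrite ger0_norm ?frob_ge0 //; apply: le_trans; exact: le_entry_frob.
Qed.

Lemma cvg_frob p q (A : T -> 'M[R]_(p, q)) (L : 'M[R]_(p, q)) :
  A x @[x --> F] --> L -> frob (A x) @[x --> F] --> frob L.
Proof.
move=> h; apply: (@cvg_comp _ _ _ (fun x => \tr ((A x)^T *m A x)) Num.sqrt).
  by apply: cvg_mxtrace; apply: cvg_mulmx; [exact: cvg_trmx h | exact: h].
exact: sqrt_continuous.
Qed.

End MatrixLimits.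

(** * Fréchet differentials and product rules *)

Section Differentials.
Context {R : realType} {V W : normedModType R}.

Lemma differentiable_littleo (f : V -> W) (df : {linear V -> W}) x :
  continuous df ->
  (forall e, 0 < e -> \forall h \near 0, `|f (h + x) - (f x + df h)| <= e * `|h|) ->
  differentiable f x /\ 'd f x = df :> (V -> W).
Proof.
move=> cdf fo.
have fE : f \o shift x = cst (f x) + df +o_ 0 id.
  apply/eqaddoP => e e0; apply: filterS (fo e e0) => h.
  by rewrite !fctE.
have dE := diff_unique cdf fE; split => //.
by apply/diff_locallyP; rewrite dE.
Qed.

Lemma littleo_differentiable (f : V -> W) x : differentiable f x ->
  forall e, 0 < e ->
    \forall h \near 0, `|f (h + x) - (f x + 'd f x h)| <= e * `|h|.
Proof.
move=> /diff_locallyP[_ /eqaddoP fo] e e0.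
by apply: filterS (fo e e0) => h; rewrite !fctE.
Qed.

Lemma nearD (P : V -> Prop) x : (\near x, P x) -> \forall h \near 0, P (h + x).
Proof. by rewrite (near_shift 0); apply: filterS => h; rewrite /= subr0. Qed.

Lemma differentiable_near (f g : V -> W) x :
  {near x, f =1 g} -> differentiable f x -> differentiable g x.
Proof.
move=> fg df; have fgx := nbhs_singleton fg.
have [] // := @differentiable_littleo g ('d f x) x (diff_continuous df).
move=> e e0; apply: filterS2 (nearD fg) (littleo_differentiable df e0) => h.
by rewrite fgx => ->.
Qed.

End Differentials.

Section Caratheodory.
Context {R : realType} {V : normedModType R}.

(* Carathéodory: only the factor that vanishes at [x] needs a derivative. *)
Lemma differentiable_caratheodory (a h : V -> R) x :
  {for x, continuous a} -> differentiable h x -> h x = 0 ->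
  differentiable (fun y => a y * h y) x /\
  forall e, 'D_e (fun y => a y * h y) x = a x * 'D_e h x.
Proof.
move=> ca dh h0.
have cdh : continuous (a x \*: ('d h x : V -> R)).
  by move=> v; apply: cvgZl_tmp; exact: diff_continuous.
suff [df dE] : differentiable (fun y => a y * h y) x /\
    'd (fun y => a y * h y) x = a x \*: ('d h x : V -> R) :> (V -> R).
  by split=> // e; rewrite deriveE // dE deriveE.
apply: differentiable_littleo => // e e0.
(* As [h x = 0], the Lipschitz constant [k] of the differential and the little-o bound with constant
   [1] give [|h (t + x)| <= (k + 1) |t|]. One half of [e] pays for the variation of [a], the other
   for the remainder of [h]; adding [1] to [|a x|] makes [M] a legitimate divisor. *)
have [k k0 dhk] := linear_lipschitz (diff_continuous dh).
have ho := littleo_differentiable dh.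
have h1 := ho 1 ltr01.
pose M := `|a x| + 1; have M0 : 0 < M by rewrite ltr_wpDl.
have he := ho (e / 2 / M) (divr_gt0 (divr_gt0 e0 (ltr0n _ 2)) M0).
have ek0 : 0 < e / 2 / (k + 1) by rewrite divr_gt0 ?divr_gt0 // addr_gt0.
have ha := nearD ((cvgrPdist_le _ _).1 ca _ ek0).
near=> t.
rewrite h0 mulr0 add0r.
have E1 : `|a (t + x) - a x| <= e / 2 / (k + 1) by rewrite distrC; near: t; exact: ha.
have E2 : `|h (t + x) - 'd h x t| <= e / 2 / M * `|t|.
  by rewrite -['d h x t]add0r -h0; near: t; exact: he.
have E3 : `|h (t + x)| <= (k + 1) * `|t|.
  rewrite -[h _](subrK ('d h x t)) (le_trans (ler_normD _ _)) // addrC mulrDl.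
  rewrite mul1r lerD // -['d h x t]add0r -h0 -[`|t|]mul1r; near: t; exact: h1.
have -> : a (t + x) * h (t + x) - (a x \*: ('d h x : V -> R)) t =
   (a (t + x) - a x) * h (t + x) + a x * (h (t + x) - 'd h x t).
  by rewrite mulrBl mulrBr addrA subrK.
rewrite (le_trans (ler_normD _ _)) // !normrM.
rewrite [e]splitr mulrDl lerD //.
  have -> : e / 2 * `|t| = e / 2 / (k + 1) * ((k + 1) * `|t|).
    by field; rewrite gt_eqF // addr_gt0.
  exact: ler_pM.
have -> : e / 2 * `|t| = M * (e / 2 / M * `|t|) by field; rewrite gt_eqF.
by rewrite ler_pM // lerDl.
Unshelve. all: by end_near. Qed.

End Caratheodory.

(** [L] is a plain function, so that explicit formulas can be used without first proving them
    linear; linearity is implied by differentiability. *)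
Definition has_deriv {R : realType} {V W : normedModType R}
    (f : V -> W) (x : V) (L : V -> W) : Prop :=
  differentiable f x /\ forall e, 'D_e f x = L e.

Section HasDeriv.
Context {R : realType} {V : normedModType R}.
Implicit Types (W : normedModType R) (x : V).

Lemma has_deriv_derivable W (f : V -> W) x L e : has_deriv f x L -> derivable f x e.
Proof. by move=> [df _]; exact: diff_derivable. Qed.

Lemma has_deriv_continuous W (f : V -> W) x L :
  has_deriv f x L -> {for x, continuous f}.
Proof. by move=> [df _]; exact: differentiable_continuous. Qed.

Lemma eq_has_deriv W (f : V -> W) x L L' :
  (forall e, L e = L' e) -> has_deriv f x L -> has_deriv f x L'.
Proof. by move=> LL [df h]; split=> // e; rewrite h. Qed.

Lemma has_deriv_near W (f g : V -> W) x L :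
  {near x, f =1 g} -> has_deriv f x L -> has_deriv g x L.
Proof.
move=> fg [df h]; split; first exact: differentiable_near df.
by move=> e; rewrite -h; apply/esym; exact: near_eq_derive.
Qed.

Lemma has_deriv_cst W (a : W) x : has_deriv (fun=> a) x (fun=> 0).
Proof. by split=> [|e]; [exact: differentiable_cst|exact: derive_cst]. Qed.

Lemma has_derivD W (f g : V -> W) x Lf Lg :
  has_deriv f x Lf -> has_deriv g x Lg ->
  has_deriv (fun y => f y + g y) x (fun e => Lf e + Lg e).
Proof.
move=> [df hf] [dg hg]; split; first exact: differentiableD.
by move=> e; rewrite -hf -hg; apply: deriveD; exact: diff_derivable.
Qed.

Lemma has_derivN W (f : V -> W) x L :
  has_deriv f x L -> has_deriv (fun y => - f y) x (fun e => - L e).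
Proof.
move=> [df h]; split; first exact: differentiableN.
by move=> e; rewrite -h; apply: deriveN; exact: diff_derivable.
Qed.

Lemma has_derivB W (f g : V -> W) x Lf Lg :
  has_deriv f x Lf -> has_deriv g x Lg ->
  has_deriv (fun y => f y - g y) x (fun e => Lf e - Lg e).
Proof. by move=> hf hg; apply: has_derivD => //; exact: has_derivN. Qed.

Lemma has_deriv_sum W k (f : 'I_k -> V -> W) x L :
  (forall i, has_deriv (f i) x (L i)) ->
  has_deriv (fun y => \sum_i f i y) x (fun e => \sum_i L i e).
Proof.
elim: k f L => [|k IH] f L h.
  have -> : (fun y => \sum_i f i y) = fun=> 0 by apply/funext => y; rewrite big_ord0.
  by apply: eq_has_deriv (has_deriv_cst _ _) => e; rewrite big_ord0.
have -> : (fun y => \sum_i f i y) =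
    fun y => \sum_(i < k) f (widen_ord (leqnSn k) i) y + f ord_max y.
  by apply/funext => y; rewrite big_ord_recr.
apply: eq_has_deriv (has_derivD (IH _ _ (fun i => h (widen_ord (leqnSn k) i))) (h ord_max)) => e.
by rewrite big_ord_recr.
Qed.

Lemma has_deriv_mxP p q (A : V -> 'M[R]_(p, q)) x L :
  has_deriv A x L <->
  forall i j, has_deriv (fun y => A y i j) x (fun e => L e i j).
Proof.
have dE : (forall i j, differentiable (fun y => A y i j) x) -> differentiable A x.
  move=> h; pose c i (j : 'I_q) y : 'M[R]_(p, q) := A y i j *: delta_mx i j.
  have -> : A = \sum_(i < p) \sum_(j < q) c i j.
    apply/funext => y; rewrite fct_sumE [LHS]matrix_sum_delta.
    by apply: eq_bigr => i _; rewrite fct_sumE.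
  apply: differentiable_sum => i; apply: differentiable_sum => j.
  exact: differentiableZl.
split=> [[dA h] i j|h].
  have dAij : differentiable (fun y => A y i j) x.
    exact: (@differentiable_comp _ _ _ _ A (fun M : 'M[R]_(p, q) => M i j) x dA (differentiable_coord _ i j)).
  split=> // e; rewrite -h derive_mx ?mxE //; exact: diff_derivable.
have dA : differentiable A x by apply: dE => i j; exact: (h i j).1.
split=> // e; rewrite derive_mx; last exact: diff_derivable.
by apply/matrixP => i j; rewrite mxE (h i j).2.
Qed.

Lemma has_deriv_trmx p q (A : V -> 'M[R]_(p, q)) x L :
  has_deriv A x L -> has_deriv (fun y => (A y)^T) x (fun e => (L e)^T).
Proof.
move=> /has_deriv_mxP h; apply/has_deriv_mxP => i j.
have := h j i; rewrite -[fun y => A y j i]/(fun y => _).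
have -> : (fun y => (A y)^T i j) = fun y => A y j i by apply/funext => y; rewrite mxE.
by apply: eq_has_deriv => e; rewrite mxE.
Qed.

Lemma has_deriv_mxtrace p (A : V -> 'M[R]_p) x L :
  has_deriv A x L -> has_deriv (fun y => \tr (A y)) x (fun e => \tr (L e)).
Proof. by move=> /has_deriv_mxP h; apply: has_deriv_sum => i; exact: h. Qed.

Lemma has_deriv_scalar_mx p (f : V -> R) x L : has_deriv f x L ->
  has_deriv (fun y => (f y)%:M : 'M[R]_p) x (fun e => (L e)%:M).
Proof.
move=> h; apply/has_deriv_mxP => i j.
have -> : (fun y => ((f y)%:M : 'M[R]_p) i j) = fun y => f y *+ (i == j).
  by apply/funext => y; rewrite mxE.
apply: (@eq_has_deriv _ _ _ (fun e => L e *+ (i == j))) => [e|].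
  by rewrite mxE.
by case: (i == j) => //=; exact: has_deriv_cst.
Qed.

(** Carathéodory's rule for matrix products, entry by entry. It lets eigenprojections and resolvents
    enter as coefficients while they are only known to be continuous. *)
Lemma has_deriv_mull p q r (A : V -> 'M[R]_(p, q)) (B : V -> 'M[R]_(q, r)) x L :
  {for x, continuous A} -> has_deriv B x L -> B x = 0 ->
  has_deriv (fun y => A y *m B y) x (fun e => A x *m L e).
Proof.
move=> /cvg_mxP cA /has_deriv_mxP hB B0; apply/has_deriv_mxP => i j.
have -> : (fun y => (A y *m B y) i j) = fun y => \sum_k A y i k * B y k j.
  by apply/funext => y; rewrite mxE.
apply: (@eq_has_deriv _ _ _ (fun e => \sum_k A x i k * L e k j)) => [e|].
  by rewrite mxE.
apply: has_deriv_sum => k; have [dB hBE] := hB k j.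
have [|d h] := differentiable_caratheodory (cA i k) dB; first by rewrite B0 mxE.
by split=> // e; rewrite h hBE.
Qed.

Lemma has_deriv_mulr p q r (A : V -> 'M[R]_(p, q)) (B : V -> 'M[R]_(q, r)) x L :
  {for x, continuous B} -> has_deriv A x L -> A x = 0 ->
  has_deriv (fun y => A y *m B y) x (fun e => L e *m B x).
Proof.
move=> cB hA A0.
have -> : (fun y => A y *m B y) = fun y => ((B y)^T *m (A y)^T)^T.
  by apply/funext => y; rewrite -trmx_mul trmxK.
apply: (@eq_has_deriv _ _ _ (fun e => ((B x)^T *m (L e)^T)^T)) => [e|].
  by rewrite -trmx_mul trmxK.
apply: has_deriv_trmx; apply: has_deriv_mull; last by rewrite A0 trmx0.
  exact: cvg_trmx.
exact: has_deriv_trmx.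
Qed.

Lemma has_deriv_mulmx p q r (A : V -> 'M[R]_(p, q)) (B : V -> 'M[R]_(q, r)) x LA LB :
  has_deriv A x LA -> has_deriv B x LB ->
  has_deriv (fun y => A y *m B y) x (fun e => LA e *m B x + A x *m LB e).
Proof.
move=> hA hB.
(* Each nonconstant summand has a factor vanishing at [x], so the Leibniz rule reduces to the two
   Carathéodory rules. *)
have -> : (fun y => A y *m B y) = fun y =>
    ((A y - A x) *m B x + A y *m (B y - B x)) + A x *m B x.
  by apply/funext => y; rewrite mulmxBl mulmxBr addrAC subrK addrC subrK.
apply: (@eq_has_deriv _ _ _ (fun e => ((LA e - 0) *m B x + A x *m (LB e - 0)) + 0)) => [e|].
  by rewrite !subr0 addr0.
apply: has_derivD; last exact: has_deriv_cst.
apply: has_derivD.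
  apply: (@has_deriv_mulr _ _ _ (fun y => A y - A x) (fun=> B x)).
  - exact: cvg_cst.
  - by apply: has_derivB => //; exact: has_deriv_cst.
  - by rewrite subrr.
apply: has_deriv_mull; last by rewrite subrr.
  exact: has_deriv_continuous hA.
by apply: has_derivB => //; exact: has_deriv_cst.
Qed.

Lemma has_deriv_mulmxl p q r (A : 'M[R]_(p, q)) (B : V -> 'M[R]_(q, r)) x L :
  has_deriv B x L -> has_deriv (fun y => A *m B y) x (fun e => A *m L e).
Proof.
move=> hB; apply: eq_has_deriv (has_deriv_mulmx (has_deriv_cst A x) hB) => e.
by rewrite mul0mx add0r.
Qed.

Lemma has_deriv_mulmxr p q r (A : V -> 'M[R]_(p, q)) (B : 'M[R]_(q, r)) x L :
  has_deriv A x L -> has_deriv (fun y => A y *m B) x (fun e => L e *m B).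
Proof.
move=> hA; apply: eq_has_deriv (has_deriv_mulmx hA (has_deriv_cst B x)) => e.
by rewrite mulmx0 addr0.
Qed.

End HasDeriv.

(** * Perturbation of an eigenprojection of constant rank *)

(** [S] is the Moore-Penrose inverse of [a - X], and the last equation forces [P] to project onto
    the whole eigenspace. The perturbation argument rests on these equations alone, so it involves
    neither an eigenbasis nor an ordering of eigenvalues. *)
Record reduced_resolvent {R : realType} {m : nat}
    (X : 'M[R]_m) (a : R) (P S : 'M[R]_m) : Prop := ReducedResolvent {
  rr_symX : X^T = X;
  rr_symP : P^T = P;
  rr_symS : S^T = S;
  rr_idemP : P *m P = P;
  rr_XP : X *m P = a *: P;
  rr_SP : S *m P = 0;
  rr_SX : S *m (a%:M - X) = 1%:M - P
}.

Section ReducedResolvent.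
Context {R : realType} {m : nat} {X : 'M[R]_m} {a : R} {P S : 'M[R]_m}.
Hypothesis rr : reduced_resolvent X a P S.

Lemma rr_PX : P *m X = a *: P.
Proof.
case: rr => XT PT _ _ XP _ _.
by apply: trmx_inj; rewrite trmx_mul XT PT XP linearZ /= PT.
Qed.

Lemma rr_PS : P *m S = 0.
Proof.
by case: rr => _ PT ST _ _ SP _; apply: trmx_inj; rewrite trmx_mul PT ST SP trmx0.
Qed.

Lemma rr_XS : (a%:M - X) *m S = 1%:M - P.
Proof.
case: rr => XT PT ST _ _ _ SX; apply: trmx_inj.
rewrite trmx_mul ST [X in _ *m X]linearB [RHS]linearB /= tr_scalar_mx XT trmx1 PT.
exact: SX.
Qed.

(** On the range of [P] the first factor is the identity and on the complement it is [a - X]. This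
    expresses [S] by a genuine matrix inverse, whose continuity is known. *)
Lemma rr_inverse : (a%:M - X + P) *m (S + P) = 1%:M.
Proof.
rewrite mulmxDl !mulmxDr rr_XS rr_PS mulmxBl mul_scalar_mx (rr_XP rr) subrr.
by rewrite (rr_idemP rr) addr0 add0r subrK.
Qed.

End ReducedResolvent.

Section ResolventDifference.
Context {R : realType} {m : nat} {X X0 : 'M[R]_m} {a a0 : R} {P P0 S S0 : 'M[R]_m}.
Hypothesis rr : reduced_resolvent X a P S.
Hypothesis rr0 : reduced_resolvent X0 a0 P0 S0.
Let D := (X - X0) - (a - a0)%:M.

Let DP : D *m P = (a0%:M - X0) *m P.
Proof.
rewrite /D mulmxBl mulmxBl (rr_XP rr) !mul_scalar_mx mulmxBl mul_scalar_mx scalerBl.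
by rewrite opprB addrC -!addrA addKr.
Qed.

Let P0D : P0 *m D = - (P0 *m (a%:M - X)).
Proof.
rewrite /D !mulmxBr (rr_PX rr0) !mul_mx_scalar scalerBl.
by rewrite !opprB addrA subrK addrC.
Qed.

(** Write [P - P0 = (1 - P0) P - P0 (1 - P)] and expand [1 - P0 = S0 (a0 - X0)] and
    [1 - P = (a - X) S]; next to [P], respectively [P0], these differences become [D] and [- D]. *)
Lemma projection_difference : P - P0 = S0 *m D *m P + P0 *m D *m S.
Proof.
rewrite -mulmxA DP mulmxA (rr_SX rr0) P0D mulNmx -mulmxA (rr_XS rr).
by rewrite mulmxBl mulmxBr mul1mx mulmx1 opprB addrA subrK.
Qed.

(** [P0 D P = P0 (a0 - X0) P] vanishes because [P0] annihilates [a0 - X0]; the trace separates the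
    scalar part of [D]. *)
Lemma eigenvalue_difference :
  (a - a0) * \tr (P0 *m P) = \tr (P0 *m (X - X0) *m P).
Proof.
have /eqP : P0 *m D *m P = 0.
  rewrite -mulmxA DP mulmxA mulmxBr mul_mx_scalar (rr_PX rr0) subrr mul0mx //.
rewrite /D mulmxBr mulmxBl subr_eq0 => /eqP ->.
by rewrite mul_mx_scalar -scalemxAl mxtraceZ.
Qed.

Lemma projection_difference_sqr : \tr P = \tr P0 ->
  \tr ((P - P0)^T *m (P - P0)) = 2 * \tr (S0 *m D *m P).
Proof.
move=> tP; rewrite -mulmxA DP mulmxA (rr_SX rr0) mulmxBl mul1mx.
have -> : (P - P0)^T = P - P0 by rewrite linearB /= (rr_symP rr) (rr_symP rr0).
rewrite mulmxBl !mulmxBr.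
rewrite (rr_idemP rr) (rr_idemP rr0) !raddfB /= (mxtrace_mulC P) tP; ring.
Qed.

End ResolventDifference.

Section Perturbation.
Context {R : realType} {V : normedModType R} {m : nat}.
Context {H P S : V -> 'M[R]_m} {lam : V -> R} {d : R} {x : V}.
Hypothesis d_gt0 : 0 < d.
Hypothesis rrH : \forall y \near x, reduced_resolvent (H y) (lam y) (P y) (S y).
Hypothesis trP : \forall y \near x, \tr (P y) = d.

Let rrx : reduced_resolvent (H x) (lam x) (P x) (S x) := nbhs_singleton rrH.
Let D y := (H y - H x) - (lam y - lam x)%:M.

Section Continuity.
Hypothesis cH : {for x, continuous H}.
Hypothesis clam : {for x, continuous lam}.

Let D0 : D y @[y --> x] --> (0 : 'M[R]_m).
Proof.
have -> : (0 : 'M[R]_m) = (H x - H x) - (lam x - lam x)%:M.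
  by rewrite !subrr (raddf0 (@scalar_mx R m)) subr0.
apply: cvgB; first by apply: cvgB => //; exact: cvg_cst.
by apply: cvg_scalar_mx; apply: cvgB => //; exact: cvg_cst.
Qed.

(* Projections of equal rank satisfy [|P - P0|^2 = 2 * tr ((1 - P0) *m P)]. *)
Lemma continuous_projection : {for x, continuous P}.
Proof.
suff P0 : P y - P x @[y --> x] --> (0 : 'M[R]_m).
  have -> : P = (fun y => (P y - P x) + P x) by apply/funext => y; rewrite subrK.
  rewrite /prop_for /continuous_at subrr.
  by apply: cvgD => //; exact: cvg_cst.
apply: cvg_frob0.
(* Cauchy-Schwarz and [|P y| = sqrt d] bound the square norm by [2 |S x D y| sqrt d]. The transpose
   matches the form of the trace pairing. *)
have lim0 : Num.sqrt (2 * (frob (S x *m D y)^T * Num.sqrt d)) @[y --> x] --> (0 : R).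
  apply: (@cvg_comp _ _ _ (fun y => 2 * (frob (S x *m D y)^T * Num.sqrt d)) Num.sqrt).
    apply: cvgM; first exact: cvg_cst.
    apply: cvgM; last exact: cvg_cst.
    apply: cvg_frob; apply: cvg_trmx; apply: cvg_mulmx; first exact: cvg_cst.
    exact: D0.
  rewrite (mulmx0 _ (S x)) trmx0 /frob trmx0 mulmx0 mxtrace0 sqrtr0 mul0r mulr0.
  by have := @sqrt_continuous R 0; rewrite /continuous_at sqrtr0.
apply: (squeeze_cvgr _ (cvg_cst _) lim0); near=> y.
rewrite frob_ge0 /= {1}/frob ler_wsqrtr //.
have rry : reduced_resolvent (H y) (lam y) (P y) (S y) by near: y.
have ty : \tr (P y) = d by near: y.
rewrite (projection_difference_sqr rry rrx) ?ty ?(nbhs_singleton trP) // ler_pM2l //.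
have fP : frob (P y) = Num.sqrt d by rewrite /frob (rr_symP rry) (rr_idemP rry) ty.
rewrite -fP; have := frob_CS (S x *m D y)^T (P y); rewrite trmxK.
exact: le_trans (ler_norm _).
Unshelve. all: by end_near. Qed.

Lemma continuous_reduced_resolvent : {for x, continuous S}.
Proof.
pose K y := (lam y)%:M - H y + P y.
have cK : K y @[y --> x] --> K x.
  apply: cvgD; last exact: continuous_projection.
  by apply: cvgB => //; exact: cvg_scalar_mx.
have Kinv y : reduced_resolvent (H y) (lam y) (P y) (S y) ->
    K y \in unitmx /\ invmx (K y) - P y = S y.
  move=> /rr_inverse KG; have [Ku _] := mulmx1_unit KG; split => //.
  by apply/eqP; rewrite subr_eq -[S y + P y](mulKmx Ku) KG mulmx1.
have [Kx Sx] := Kinv _ rrx; rewrite /prop_for /continuous_at -Sx.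
have cS : invmx (K y) - P y @[y --> x] --> invmx (K x) - P x.
  by apply: cvgB; [exact: cvg_invmx|exact: continuous_projection].
apply: cvg_trans cS; apply: near_eq_cvg; apply: filterS rrH => y /Kinv[_ ->].
by [].
Qed.
End Continuity.

Section Differentiability.
Context (dH : V -> 'M[R]_m).
Hypothesis hH : has_deriv H x dH.
Hypothesis clam : {for x, continuous lam}.

Let cH : {for x, continuous H}. Proof. exact: has_deriv_continuous hH. Qed.
Let cP : {for x, continuous P}. Proof. exact: continuous_projection. Qed.
Let cS : {for x, continuous S}. Proof. exact: continuous_reduced_resolvent. Qed.

Lemma has_deriv_eigenvalue : has_deriv lam x (fun e => d^-1 * \tr (P x *m dH e)).
Proof.
have trPx : \tr (P x) = d := nbhs_singleton trP.
(* The exact identity divides by [t y], which tends to [d > 0]. Continuity of [t] suffices, since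
   [H y - H x] vanishes at [x]. *)
pose t y := \tr (P x *m P y).
have ct : t y @[y --> x] --> d.
  rewrite -trPx -(rr_idemP rrx); apply: cvg_mxtrace; apply: cvg_mulmx => //.
  exact: cvg_cst.
have hf : has_deriv (fun y => \tr (((t y)^-1 *: P y) *m (P x *m (H y - H x)))) x
    (fun e => \tr (((t x)^-1 *: P x) *m (P x *m (dH e - 0)))).
  apply: has_deriv_mxtrace; apply: has_deriv_mull.
  - apply: cvgZ => //; apply: cvgV; last by rewrite /t (rr_idemP rrx) trPx.
    by rewrite /t (rr_idemP rrx) trPx gt_eqF.
  - apply: has_deriv_mulmxl; apply: has_derivB => //; exact: has_deriv_cst.
  - by rewrite subrr mulmx0.
have := has_derivD hf (has_deriv_cst (lam x) x).
have tx : t x = d by rewrite /t (rr_idemP rrx).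
move=> h; apply: has_deriv_near (eq_has_deriv _ h); last first.
  move=> e; rewrite addr0 subr0 tx -scalemxAl mxtraceZ mulmxA (rr_idemP rrx) //.
near=> y.
have ty : t y != 0 by rewrite gt_eqF //; near: y; exact: (cvgr_gt d ct).
have rry : reduced_resolvent (H y) (lam y) (P y) (S y) by near: y.
rewrite -scalemxAl mxtraceZ mxtrace_mulC -(eigenvalue_difference rry rrx).
by rewrite mulrC -/(t y) mulfK // subrK.
Unshelve. all: by end_near. Qed.

Lemma has_deriv_projection :
  has_deriv P x (fun e => S x *m dH e *m P x + P x *m dH e *m S x).
Proof.
have hl := has_deriv_eigenvalue; set dl := (fun e => _) in hl.
have hD : has_deriv D x (fun e => (dH e - 0) - (dl e - 0)%:M).
  apply: has_derivB; first by apply: has_derivB => //; exact: has_deriv_cst.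
  by apply: has_deriv_scalar_mx; apply: has_derivB => //; exact: has_deriv_cst.
have Dx : D x = 0 by rewrite /D !subrr (raddf0 (@scalar_mx R m)) subr0.
have h1 := has_deriv_mulr cP (has_deriv_mulmxl (S x) hD); rewrite Dx mulmx0 in h1.
have h2 := has_deriv_mulr cS (has_deriv_mulmxl (P x) hD); rewrite Dx mulmx0 in h2.
have h := has_derivD (has_derivD (h1 erefl) (h2 erefl)) (has_deriv_cst (P x) x).
apply: has_deriv_near (eq_has_deriv _ h).
  apply: filterS rrH => y rry.
  by rewrite -(projection_difference rry rrx) subrK.
(* The scalar part of the derivative of [D] disappears because [S P = P S = 0]. *)
move=> e; rewrite addr0 !subr0 !mulmxBr !mulmxBl !mul_mx_scalar -!scalemxAl.
by rewrite (rr_SP rrx) (rr_PS rrx) scaler0 !subr0.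
Qed.

End Differentiability.
End Perturbation.

(** * Functions of a column vector *)

Section ColumnCalculus.
Context {R : realType} {n : nat}.
Implicit Types (x a b e : 'cV[R]_n).

Lemma within_openP (W : topologicalType) (Omega : set 'cV[R]_n) (F : 'cV[R]_n -> W) :
  open Omega ->
  {within Omega, continuous F} <-> forall x, Omega x -> {for x, continuous F}.
Proof.
move=> oO; rewrite continuous_open_subspace //; split=> h x; last by rewrite inE; exact: h.
by move=> Ox; apply: h; rewrite inE.
Qed.

Lemma col_sum_delta e : e = \sum_j e j 0 *: delta_mx j 0.
Proof. by rewrite [LHS]matrix_sum_delta; apply: eq_bigr => j _; rewrite big_ord1. Qed.

Lemma grad_mul (f : 'cV[R]_n -> R) x e :
  differentiable f x -> (grad f x *m e) 0 0 = 'D_e f x.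
Proof.
move=> df; rewrite deriveE // [in RHS](col_sum_delta e) linear_sum mxE.
by apply: eq_bigr => j _; rewrite mxE linearZ /= mulrC.
Qed.

Lemma jac_mul k (F : 'cV[R]_n -> 'cV[R]_k) x e :
  differentiable F x -> jac F x *m e = 'D_e F x.
Proof.
move=> dF; rewrite deriveE // [in RHS](col_sum_delta e) linear_sum.
apply/matrixP => i j; rewrite ord1 mxE summxE.
by apply: eq_bigr => c _; rewrite !mxE linearZ /= mxE mulrC.
Qed.

Lemma nabla_mul p k (F : 'cV[R]_n -> 'M[R]_(p, k)) q x e :
  differentiable F x -> nabla q F x *m e = 'D_e F x *m q.
Proof.
move=> dF; have [d h] := @has_deriv_mulmxr _ _ _ _ _ F q x _ (conj dF (fun=> erefl)).
by rewrite /nabla jac_mul // h.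
Qed.

Lemma eq_bilinear_mx p q (M N : 'M[R]_(p, q)) :
  (forall (a : 'cV[R]_p) (b : 'cV[R]_q), (a^T *m M *m b) 0 0 = (a^T *m N *m b) 0 0) ->
  M = N.
Proof.
move=> h; apply/matrixP => i j; have := h (delta_mx i 0) (delta_mx j 0).
by rewrite !trmx_delta -!rowE -!colE !mxE.
Qed.

(** A gradient field is known through its pairings with fixed vectors, which are directional
    derivatives near [x]. Pairing with basis vectors recovers its coordinates, hence its
    differentiability. *)
Lemma jac_weak k (G : 'cV[R]_n -> 'cV[R]_k) x (g L : 'cV[R]_k -> 'cV[R]_n -> R) :
  (forall c, \forall y \near x, (c^T *m G y) 0 0 = g c y) ->
  (forall c, has_deriv (g c) x (L c)) ->
  differentiable G x /\ forall c b, (c^T *m jac G x *m b) 0 0 = L c b.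
Proof.
move=> Gg gL.
have hG : has_deriv G x (fun e => \col_i L (delta_mx i 0) e).
  apply/has_deriv_mxP => i j; rewrite (ord1 j).
  apply: has_deriv_near (eq_has_deriv _ (gL (delta_mx i 0))) => [|e]; last by rewrite mxE.
  by apply: filterS (Gg (delta_mx i 0)) => y; rewrite trmx_delta -rowE !mxE.
split=> [|c b]; first exact: hG.1.
rewrite -mulmxA jac_mul; last exact: hG.1.
have /has_deriv_mxP/(_ 0 0) h := has_deriv_mulmxl c^T (conj hG.1 (fun=> erefl)).
rewrite -h.2 -(gL c).2; apply: near_eq_derive; exact: Gg.
Qed.

(** The image is an interval, and an interval containing naturals [k < i] also contains
    [k + 1/2]. *)
Lemma connected_nat_valued (Omega : set 'cV[R]_n) (f : 'cV[R]_n -> R) :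
  connected Omega -> {within Omega, continuous f} ->
  (forall x, Omega x -> exists k : nat, f x = k%:R) ->
  forall x y, Omega x -> Omega y -> f x = f y.
Proof.
move=> cO cf fN.
have /connected_intervalP fI := connected_continuous_connected cO cf.
have le x y : Omega x -> Omega y -> f x <= f y.
  move=> Ox Oy; rewrite leNgt; apply/negP => fyx.
  have [i fi] := fN x Ox; have [k fk] := fN y Oy.
  have ki : (k < i)%N by rewrite -(ltr_nat R) -fi -fk.
  have [z Oz fz] : (f @` Omega) (k%:R + 2^-1).
    apply: (fI (f y) (f x)); [by exists y|by exists x|].
    rewrite fk lerDl invr_ge0 ler0n /= fi.
    apply: (@le_trans _ _ k.+1%:R); last by rewrite ler_nat.
    by rewrite -[k.+1%:R]natr1 lerD2l invf_le1 ?ler1n ?ltr0n.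
  have [c fc] := fN z Oz; move: fz; rewrite fc => cE.
  have : (k < c)%N by rewrite -(ltr_nat R) cE ltrDl invr_gt0 ltr0n.
  have : (c < k.+1)%N.
    by rewrite -(ltr_nat R) cE -[k.+1%:R]natr1 ltrD2l invf_lt1 ?ltr1n ?ltr0n.
  by rewrite ltnS leqNgt => /negP.
by move=> x y Ox Oy; apply/eqP; rewrite eq_le !le.
Qed.

Lemma enorm_continuous k : continuous (@enorm R k).
Proof.
move=> y; have -> : @enorm R k = @frob R k 1 by apply/funext => z; exact: enormE.
exact: (@cvg_frob R _ (nbhs y) _ k 1 id y cvg_id).
Qed.

Lemma usphere_max (f : 'cV[R]_n -> R) : (0 < n)%N -> continuous f ->
  (* The extreme value theorem is applied on row vectors, so the sphere is transported by
     transposition; [0 < n] makes it nonempty. *)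
  exists M, is_maximum [set f e | e in usphere n] M.
Proof.
move=> n0 cf; pose A : set 'rV[R]_n := (@trmx R 1 n) @^-1` usphere n.
have ctr : continuous (@trmx R 1 n) by move=> y; exact: (@cvg_trmx R _ (nbhs y) _ 1 n id y cvg_id).
have clA : closed A.
  apply: preimage_closed => [y _|]; first exact: ctr.
  apply: (@preimage_closed _ _ (@enorm R n) [set z | z = 1]) => [y _|].
    exact: enorm_continuous.
  exact: closed_eq.
have bA : bounded_set A.
  exists 1; split => [|M M1 y Ay]; first exact: num_real.
  apply: le_trans (ltW M1); rewrite [leLHS]mx_normrE bigmax_le // => -[i j] _ /=.
  by rewrite -Ay enormE; have := le_entry_frob y^T j i; rewrite mxE.
have A0 : A !=set0.
  exists (delta_mx 0 (Ordinal n0)).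
  rewrite /A /= /usphere /= trmx_delta /enorm trmx_delta mul_delta_mx mxE.
  by rewrite !eqxx sqrtr1.
have [] := @EVT_max_rV R n (f \o trmx) A A0 (bounded_closed_compact bA clA).
  apply: continuous_subspaceT => y; apply: continuous_comp; first exact: ctr.
  exact: cf.
move=> c; rewrite inE => Ac fc; exists (f c^T); split; first by exists c^T.
move=> _ [e Ue <-]; have := fc e^T; rewrite /= trmxK; apply.
by rewrite inE /A /= trmxK.
Qed.

End ColumnCalculus.

Section Eigenvectors.
Context {R : realType} {m : nat}.

Lemma unit_eigvec_quad (P M : 'M[R]_m) c xi : P^T = P -> P *m P = P ->
  c *: P = P *m M *m P -> unit_eigvec P xi -> c = (xi^T *m M *m xi) 0 0.
Proof.
move=> PT PP cP [[eta _ xiE] xi1].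
have Pxi : P *m xi = xi by rewrite -xiE mulmxA PP.
have xiP : xi^T *m P = xi^T by rewrite -[in RHS]Pxi trmx_mul PT.
have := congr1 (fun Z => (xi^T *m Z *m xi) 0 0) cP.
rewrite /= -scalemxAr -scalemxAl !mulmxA !xiP -!mulmxA Pxi mulmxA => <-.
have -> : xi^T *m xi = 1%:M.
  rewrite [LHS]mx11_scalar; congr (_%:M).
  have <- : enorm xi ^+ 2 = (xi^T *m xi) 0 0.
    by rewrite enormE frob_sqr /mxtrace big_ord1.
  by rewrite xi1 expr1n.
by rewrite !mxE eqxx mulr1.
Qed.

End Eigenvectors.

(** * Eigenvalues of a matrix field *)

Lemma quad_symmetric_sandwich {R : realType} {m : nat}
    (A B C D : 'M[R]_m) (v : 'cV[R]_m) : A^T = A -> B^T = B -> C^T = C ->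
  (v^T *m (D + C *m A *m B + B *m A *m C) *m v) 0 0 =
  (v^T *m (D + 2 *: (C *m A *m B)) *m v) 0 0.
Proof.
move=> AT BT CT; rewrite scaler_nat mulr2n addrA.
have E : (v^T *m (B *m A *m C) *m v) 0 0 = (v^T *m (C *m A *m B) *m v) 0 0.
  have <- : (v^T *m (B *m A *m C) *m v)^T 0 0 = (v^T *m (B *m A *m C) *m v) 0 0.
    by rewrite mxE.
  by rewrite !trmx_mul trmxK AT BT CT !mulmxA.
by rewrite !(mulmxDr, mulmxDl) mxE [in RHS]mxE E.
Qed.

(* What remains of the derivative of [c1 *: P = P *m Da *m P] after compressing it
   with [P] on both sides, when [P' = A *m Db *m P + P *m Db *m A]. *)
Lemma compress_second_derivative {R : realType} {m : nat}
    (P A Da Db Dab : 'M[R]_m) (c c1 : R) :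
  P *m P = P -> P *m A = 0 -> A *m P = 0 ->
  let dP := A *m Db *m P + P *m Db *m A in
  c *: P + c1 *: dP = (dP *m Da + P *m Dab) *m P + P *m Da *m dP ->
  c *: P = P *m (Dab + Da *m A *m Db + Db *m A *m Da) *m P.
Proof.
move=> PP PA AP dP /(congr1 (fun Z => P *m Z *m P)) /=.
have PdP : P *m dP = P *m Db *m A.
  by rewrite /dP mulmxDr !mulmxA PA !mul0mx add0r PP.
have dPP : dP *m P = A *m Db *m P.
  by rewrite /dP mulmxDl -!mulmxA AP !mulmx0 addr0 PP.
have PdPP : P *m dP *m P = 0 by rewrite PdP -mulmxA AP mulmx0.
have PPr (X : 'M[R]_m) : X *m P *m P = X *m P by rewrite -mulmxA PP.
move: dP PdP dPP PdPP => dP PdP dPP PdPP.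
rewrite !(mulmxDl, mulmxDr, =^~ scalemxAl, =^~ scalemxAr, mulmxA).
rewrite !PPr PdPP scaler0 addr0 PdP !PP => ->.
by rewrite -[_ *m dP *m P]mulmxA dPP !mulmxA -addrA addrC.
Qed.

(** The first summand needs cyclicity of the trace, the second also transposition. With [Q = P] this
    is the trace of [P' H'], the origin of the factor 2 in the second-order formulas. *)
Lemma mxtrace_symmetric_sandwich {R : realType} {m : nat} (A B C Q : 'M[R]_m) :
  A^T = A -> B^T = B -> C^T = C -> Q^T = Q ->
  \tr ((A *m B *m Q + Q *m B *m A) *m C) = 2 * \tr (Q *m (C *m A *m B)).
Proof.
move=> AT BT CT QT; rewrite mulmxDl raddfD /= mulr_natl mulr2n; congr (_ + _).
  by rewrite -mulmxA mxtrace_mulC !mulmxA.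
by rewrite -mxtrace_tr !trmx_mul AT BT CT QT !mulmxA mxtrace_mulC !mulmxA.
Qed.

Section EigenvalueFields.
Context {R : realType} {n m : nat} {Omega : set 'cV[R]_n}.
Hypothesis openO : open Omega.
Context {H : 'cV[R]_n -> 'M[R]_m} {lam : 'I_m -> 'cV[R]_n -> R}
  {P : 'I_m -> 'cV[R]_n -> 'M[R]_m}.
Hypothesis Hsym : forall x, Omega x -> (H x)^T = H x.
Hypothesis lamE : forall x, Omega x -> repeated_eigenvalues (H x) (lam^~ x).
Hypothesis PE : forall x, Omega x ->
  forall i, is_orthproj (eigensp (H x) (lam i x)) (P i x).

Let nearO x : Omega x -> \forall y \near x, Omega y.
Proof. by move=> Ox; exact: open_nbhs_nbhs. Qed.

Lemma spectral_data x : Omega x -> exists2 U : 'M[R]_m, U^T *m U = 1%:M &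
  H x = fcalc U (lam^~ x) id /\
  forall i, P i x = fcalc U (lam^~ x) (fun t => (t == lam i x)%:R).
Proof.
move=> Ox; have [U UU HE] := symmetric_fcalc (Hsym Ox) (lamE Ox).
exists U => //; split=> // i; apply: orthproj_uniq (PE Ox i) _.
by rewrite HE; exact: fcalc_orthproj.
Qed.

Lemma spectral_decomposition x : Omega x ->
  H x = \sum_(i < m) (lam i x / \tr (P i x)) *: P i x.
Proof.
move=> Ox; have [U UU [HE PfE]] := spectral_data Ox.
rewrite HE -(fcalc_multiplicity_sum UU id PfE).
by apply: eq_bigr => i _; rewrite scalerA.
Qed.

Lemma mxtrace_eigenprojection x i : Omega x ->
  0 < \tr (P i x) /\ exists k : nat, \tr (P i x) = k%:R.
Proof.
move=> Ox; have [U UU [_ PfE]] := spectral_data Ox.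
rewrite PfE; split; first exact: mxtrace_fcalc_gt0.
exists (\sum_k (lam k x == lam i x))%N.
by rewrite mxtrace_fcalc // natr_sum.
Qed.

Lemma Amx_reduced_resolvent x j : Omega x ->
  reduced_resolvent (H x) (lam j x) (P j x) (Amx lam P j x).
Proof.
move=> Ox; have [U UU [HE PfE]] := spectral_data Ox.
(* The convention [0^-1 = 0] lets the sum run over all indices, so [A_j] is a function of [H x]; the
   same convention gives [A_j P_j = 0] below. *)
have -> : Amx lam P j x = fcalc U (lam^~ x) (fun t => (lam j x - t)^-1).
  rewrite -(fcalc_multiplicity_sum UU (fun t => (lam j x - t)^-1) PfE).
  rewrite /Amx big_mkcond; apply: eq_bigr => i _.
  by case: eqP => //= ->; rewrite subrr invr0 scale0r.
rewrite PfE HE; split; rewrite ?fcalc_tr // ?fcalcM //.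
- by apply: eq_fcalc => i; case: eqP; rewrite ?mulr1 ?mulr0.
- rewrite fcalcZ; apply: eq_fcalc => i.
  by case: eqP => [->|_] //; rewrite !mulr0.
- have -> : 0 = 0%:M :> 'M[R]_m by rewrite -scalemx1 scale0r.
  rewrite -(fcalc_cst (lam^~ x) UU); apply: eq_fcalc => i /=.
  by case: eqP => [->|_]; rewrite ?subrr ?invr0 ?mul0r ?mulr0.
- rewrite -!(fcalc_cst (lam^~ x) UU) !fcalcB fcalcM //; apply: eq_fcalc => i /=.
  have [->|ne] := eqVneq (lam i x) (lam j x); first by rewrite !subrr mulr0.
  by rewrite subr0 mulVf // subr_eq0 eq_sym.
Qed.

Let rr_near x j : Omega x ->
  \forall y \near x, reduced_resolvent (H y) (lam j y) (P j y) (Amx lam P j y).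
Proof. by move=> /nearO; apply: filterS => y; exact: Amx_reduced_resolvent. Qed.

Variable j : 'I_m.

Lemma eigenvalue_holder alpha C :
  holder_on frob Omega alpha C H -> holder_on Num.norm Omega alpha C (lam j).
Proof.
move=> hH x y Ox Oy; apply: le_trans (hH x y Ox Oy).
exact: (weyl j (Hsym Ox) (Hsym Oy) (lamE Ox) (lamE Oy)).
Qed.

Lemma eigenvalue_continuous x :
  Omega x -> {for x, continuous H} -> {for x, continuous (lam j)}.
Proof.
move=> Ox cH; apply/(@cvgrPdist_le _ _ _ (nbhs x)) => e e0.
have : frob (H x - H y) @[y --> x] --> (0 : R).
  have := @cvg_frob R _ (nbhs x) (nbhs_filter x) m m (fun y => H x - H y) (H x - H x).
  rewrite subrr {2}/frob trmx0 mulmx0 mxtrace0 sqrtr0; apply.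
  by rewrite -[X in _ --> X](subrr (H x)); apply: cvgB => //; exact: cvg_cst.
move=> /cvgr0Pnorm_le/(_ e e0); apply: filterS2 (nearO Ox) => y Oy.
rewrite ger0_norm ?frob_ge0 //; apply: le_trans.
exact: (weyl j (Hsym Ox) (Hsym Oy) (lamE Ox) (lamE Oy)).
Qed.

(** The trace of a projection is a natural number, so continuity on a connected set makes it
    constant. *)
Lemma const_dim_of_continuous : is_domain Omega ->
  cond_d Omega (P j) -> exists d, const_dim Omega (P j) d.
Proof.
move=> [[x0 Ox0] _ cO] cP; exists (\tr (P j x0)) => x Ox.
apply: (connected_nat_valued (f := fun x => \tr (P j x)) cO) => //.
  apply/(within_openP _ openO) => y Oy.
  exact: (@cvg_mxtrace R _ (nbhs y) _ m (P j) (P j y)) ((within_openP _ openO).1 cP y Oy).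
by move=> y Oy; exact: (mxtrace_eigenprojection j Oy).2.
Qed.

(** * First-order formulas and the gradient bound *)

Section FirstOrder.
Hypothesis dH : forall x, Omega x -> differentiable H x.
Context {d : R}.
Hypothesis dimP : const_dim Omega (P j) d.
Context {x : 'cV[R]_n}.
Hypothesis Ox : Omega x.

Let hH : has_deriv H x (fun e => 'D_e H x). Proof. by split; first exact: dH. Qed.

Let d_gt0 : 0 < d.
Proof. by rewrite -(dimP Ox); case: (mxtrace_eigenprojection j Ox). Qed.

Let clam : {for x, continuous (lam j)}.
Proof. by apply: eigenvalue_continuous => //; exact: has_deriv_continuous hH. Qed.

Let trP_near : \forall y \near x, \tr (P j y) = d.
Proof. by apply: filterS (nearO Ox) => y; exact: dimP. Qed.

Let rr := Amx_reduced_resolvent j Ox.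

Lemma eigenvalue_has_deriv :
  has_deriv (lam j) x (fun e => d^-1 * \tr (P j x *m 'D_e H x)).
Proof. exact: (has_deriv_eigenvalue d_gt0 (rr_near j Ox) trP_near hH clam). Qed.

Lemma eigenprojection_has_deriv : has_deriv (P j) x (fun e =>
  Amx lam P j x *m 'D_e H x *m P j x + P j x *m 'D_e H x *m Amx lam P j x).
Proof. exact: (has_deriv_projection d_gt0 (rr_near j Ox) trP_near hH clam). Qed.

(** Differentiate [H P = lambda P] and multiply by [P] on the left: the two terms containing [P']
    cancel because [P H = lambda P]. *)
Lemma derive_eigenvalue_mx e :
  'D_e (lam j) x *: P j x = P j x *m 'D_e H x *m P j x.
Proof.
have hl : has_deriv (lam j) x (fun e => 'D_e (lam j) x).
  by split=> //; exact: eigenvalue_has_deriv.1.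
have hP : has_deriv (P j) x (fun e => 'D_e (P j) x).
  by split=> //; exact: eigenprojection_has_deriv.1.
have h1 := has_deriv_mulmx hH hP.
have h2 := has_deriv_mulmx (has_deriv_scalar_mx m hl) hP.
have : 'D_e H x *m P j x + H x *m 'D_e (P j) x =
    ('D_e (lam j) x)%:M *m P j x + (lam j x)%:M *m 'D_e (P j) x.
  rewrite -h1.2 -h2.2; apply: near_eq_derive; apply: filterS (rr_near j Ox) => y rry.
  by rewrite (rr_XP rry) mul_scalar_mx.
move=> /(congr1 (mulmx (P j x))).
rewrite !mulmxDr !mulmxA (rr_PX rr) !mul_mx_scalar -!scalemxAl => /addIr.
by rewrite (rr_idemP rr).
Qed.

Lemma derive_symmetric e : ('D_e H x)^T = 'D_e H x.
Proof.
rewrite -(has_deriv_trmx hH).2; apply: near_eq_derive.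
by apply: filterS (nearO Ox) => y; exact: Hsym.
Qed.

Lemma derive_eigenvalue_quad e xi : unit_eigvec (P j x) xi ->
  'D_e (lam j) x = (xi^T *m 'D_e H x *m xi) 0 0.
Proof.
by apply: unit_eigvec_quad (rr_symP rr) (rr_idemP rr) _; exact: derive_eigenvalue_mx.
Qed.

Lemma derive_eigenvalue_nabla e xi : unit_eigvec (P j x) xi ->
  'D_e (lam j) x = (xi^T *m nabla xi H x *m e) 0 0.
Proof.
move=> uxi; rewrite -mulmxA nabla_mul; last exact: dH.
by rewrite mulmxA; exact: derive_eigenvalue_quad.
Qed.

Lemma grad_eigenvalue_nabla xi : unit_eigvec (P j x) xi ->
  grad (lam j) x = xi^T *m nabla xi H x.
Proof.
move=> uxi; apply/rowP => i.
have := grad_mul (delta_mx i 0) eigenvalue_has_deriv.1.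
by rewrite (derive_eigenvalue_nabla _ uxi) -!colE !mxE.
Qed.

Lemma enorm_grad_eigenvalue_le M :
  is_maximum [set frob ('D_e H x) | e in usphere n] M ->
  enorm (grad (lam j) x)^T <= (Num.sqrt d)^-1 * M.
Proof.
move=> [[e0 _ <-] ubM]; set M0 := frob _; set g := (grad (lam j) x)^T.
have [g0|g0] := eqVneq (enorm g) 0.
  by rewrite g0 mulr_ge0 ?invr_ge0 ?sqrtr_ge0 ?frob_ge0.
(* Along its own direction the gradient's length is a directional derivative; Cauchy-Schwarz with
   [|P| = sqrt d] then turns [1 / d] into [1 / sqrt d]. *)
pose e := (enorm g)^-1 *: g.
have ggE : (g^T *m g) 0 0 = enorm g ^+ 2.
  by rewrite enormE frob_sqr /mxtrace big_ord1.
have ue : usphere n e.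
  rewrite /usphere /= /enorm; have -> : e^T = (enorm g)^-1 *: g^T by rewrite linearZ.
  rewrite -scalemxAl -scalemxAr scalerA mxE ggE -expr2 -exprMn mulVf //.
  by rewrite expr1n sqrtr1.
have gE : enorm g = d^-1 * \tr (P j x *m 'D_e H x).
  rewrite -eigenvalue_has_deriv.2 -(grad_mul _ eigenvalue_has_deriv.1).
  rewrite -[grad _ _]trmxK -/g /e -scalemxAr mxE ggE expr2 mulrA.
  by rewrite mulVf // mul1r.
have fP : frob (P j x) = Num.sqrt d.
  by rewrite /frob (rr_symP rr) (rr_idemP rr) dimP.
have sd : 0 < Num.sqrt d by rewrite sqrtr_gt0.
have dE : d^-1 = (Num.sqrt d)^-1 * (Num.sqrt d)^-1.
  by rewrite -invfM -expr2 sqr_sqrtr // ltW.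
rewrite gE dE -mulrA ler_pM2l ?invr_gt0 // ler_pdivrMl // -fP.
have := frob_CS (P j x) ('D_e H x); rewrite (rr_symP rr) => h.
apply: (le_trans (ler_norm _)); apply: (le_trans h).
apply: ler_wpM2l; first exact: frob_ge0.
by apply: ubM; exists e.
Qed.

End FirstOrder.

(** * Second-order formulas and the Hessian *)

Section SecondOrder.
Hypothesis dH : forall x, Omega x -> differentiable H x.
Hypothesis ddH : forall a x, Omega x -> differentiable ('D_a H) x.
Context {d : R}.
Hypothesis dimP : const_dim Omega (P j) d.
Context {x : 'cV[R]_n}.
Hypothesis Ox : Omega x.

Let hdH a : has_deriv ('D_a H) x (fun b => 'D_b ('D_a H) x).
Proof. by split; first exact: ddH. Qed.

Let rr := Amx_reduced_resolvent j Ox.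
Let hP := eigenprojection_has_deriv dH dimP Ox.

Lemma derive_eigenvalue_has_deriv a : has_deriv ('D_a (lam j)) x (fun b =>
  d^-1 * \tr (P j x *m ('D_b ('D_a H) x
    + 2 *: ('D_a H x *m Amx lam P j x *m 'D_b H x)))).
Proof.
have h : has_deriv (fun y => \tr (d^-1%:M *m (P j y *m 'D_a H y))) x _ :=
  has_deriv_mxtrace (has_deriv_mulmxl _ (has_deriv_mulmx hP (hdH a))).
apply: has_deriv_near (eq_has_deriv _ h) => [|b].
  apply: filterS (nearO Ox) => y Oy.
  by rewrite (eigenvalue_has_deriv dH dimP Oy).2 mul_scalar_mx mxtraceZ.
rewrite mul_scalar_mx mxtraceZ; congr (_ * _).
rewrite mulmxDr !raddfD /= addrC; congr (_ + _).
rewrite mxtrace_symmetric_sandwich ?(derive_symmetric dH Ox) ?(rr_symP rr) ?(rr_symS rr) //.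
by rewrite -scalemxAr mxtraceZ.
Qed.

(** The trace formula only supplies existence of the second derivative. The matrix identity comes
    from the first-order one, which holds near [x] and can be differentiated along [b]. *)
Lemma derive2_eigenvalue_mx a b : 'D_b ('D_a (lam j)) x *: P j x =
  P j x *m ('D_b ('D_a H) x + 'D_a H x *m Amx lam P j x *m 'D_b H x
    + 'D_b H x *m Amx lam P j x *m 'D_a H x) *m P j x.
Proof.
pose dP b := Amx lam P j x *m 'D_b H x *m P j x + P j x *m 'D_b H x *m Amx lam P j x.
have hdl : has_deriv ('D_a (lam j)) x (fun b => 'D_b ('D_a (lam j)) x).
  by split=> //; exact: (derive_eigenvalue_has_deriv a).1.
have h1 := has_deriv_mulmx (has_deriv_scalar_mx m hdl) hP.
have h2 := has_deriv_mulmx (has_deriv_mulmx hP (hdH a)) hP.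
apply: (@compress_second_derivative _ _ _ (Amx lam P j x) _ _ _ _ ('D_a (lam j) x)
  (rr_idemP rr) (rr_PS rr) (rr_SP rr)).
rewrite -/(dP b) -!mul_scalar_mx -h1.2 -h2.2.
apply: near_eq_derive; apply: filterS (nearO Ox) => y Oy.
by rewrite -(derive_eigenvalue_mx dH dimP Oy) mul_scalar_mx.
Qed.
Lemma derive2_eigenvalue_quad a b xi : unit_eigvec (P j x) xi ->
  'D_b ('D_a (lam j)) x =
    (xi^T *m ('D_b ('D_a H) x
      + 2 *: ('D_a H x *m Amx lam P j x *m 'D_b H x)) *m xi) 0 0.
Proof.
move=> uxi.
rewrite (unit_eigvec_quad (rr_symP rr) (rr_idemP rr) (derive2_eigenvalue_mx a b) uxi).
by apply: quad_symmetric_sandwich; rewrite ?(derive_symmetric dH Ox) ?(rr_symS rr).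
Qed.

Lemma quad_nabla2 a b xi :
  (a^T *m (nabla xi (fun y => (nabla xi H y)^T) x
     + 2 *: ((nabla xi H x)^T *m Amx lam P j x *m nabla xi H x)) *m b) 0 0 =
  (xi^T *m ('D_b ('D_a H) x
     + 2 *: ('D_a H x *m Amx lam P j x *m 'D_b H x)) *m xi) 0 0.
Proof.
(* For fixed [xi], [(nabla xi H y)^T xi] is the gradient of [y] mapped to [xi^T H(y) xi], by
   symmetry of the derivatives of [H]; its Jacobian is therefore a Hessian. *)
have nearq c : \forall y \near x,
    (c^T *m ((nabla xi H y)^T *m xi)) 0 0 = (xi^T *m 'D_c H y *m xi) 0 0.
  apply: filterS (nearO Ox) => y Oy.
  rewrite mulmxA -trmx_mul nabla_mul; last exact: dH.
  by rewrite trmx_mul (derive_symmetric dH Oy).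
have derq c : has_deriv (fun y => (xi^T *m 'D_c H y *m xi) 0 0) x
    (fun e => (xi^T *m 'D_e ('D_c H) x *m xi) 0 0).
  by move/has_deriv_mxP: (has_deriv_mulmxr xi (has_deriv_mulmxl xi^T (hdH c))); apply.
have [_ h] := jac_weak nearq derq.
rewrite !(mulmxDr, mulmxDl) mxE [in RHS]mxE [X in X + _]h; congr (_ + _).
rewrite -!scalemxAr -!scalemxAl mxE [in RHS]mxE; congr (_ * _).
rewrite !mulmxA -trmx_mul nabla_mul; last exact: dH.
rewrite -[_ *m nabla _ _ _ *m b]mulmxA nabla_mul; last exact: dH.
by rewrite trmx_mul (derive_symmetric dH Ox) !mulmxA.
Qed.

Lemma hessian_eigenvalue :
  differentiable (grad (lam j)) x /\
  forall a b, (a^T *m hessian (lam j) x *m b) 0 0 = 'D_b ('D_a (lam j)) x.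
Proof.
have nearg c : \forall y \near x, (c^T *m (grad (lam j) y)^T) 0 0 = 'D_c (lam j) y.
  apply: filterS (nearO Ox) => y Oy.
  rewrite -trmx_mul mxE grad_mul //; exact: (eigenvalue_has_deriv dH dimP Oy).1.
have derg c : has_deriv ('D_c (lam j)) x (fun b => 'D_b ('D_c (lam j)) x).
  by split=> //; exact: (derive_eigenvalue_has_deriv c).1.
have [dg h] := jac_weak nearg derg; split=> //.
have -> : grad (lam j) = fun y => ((grad (lam j) y)^T)^T.
  by apply/funext => y; rewrite trmxK.
exact: (has_deriv_trmx (conj dg (fun=> erefl))).1.
Qed.

Lemma hessian_eigenvalue_nabla xi : unit_eigvec (P j x) xi ->
  hessian (lam j) x = nabla xi (fun y => (nabla xi H y)^T) x
    + 2 *: ((nabla xi H x)^T *m Amx lam P j x *m nabla xi H x).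
Proof.
move=> uxi; apply: eq_bilinear_mx => a b.
by rewrite hessian_eigenvalue.2 quad_nabla2; exact: derive2_eigenvalue_quad.
Qed.

End SecondOrder.
End EigenvalueFields.

Theorem theorem4p7 (R : realType) (n m : nat) (n_gt0 : (0 < n)%N)
  (Omega : set 'cV[R]_n) (domOmega : is_domain Omega)
  (H : 'cV[R]_n -> 'M[R]_m)
  (Hsym : forall x, Omega x -> (H x)^T = H x)
  (lam : 'I_m -> 'cV[R]_n -> R)
  (lamE : forall x, Omega x -> repeated_eigenvalues (H x) (lam^~ x))
  (P : 'I_m -> 'cV[R]_n -> 'M[R]_m)
  (PE : forall x, Omega x ->
     forall i, is_orthproj (eigensp (H x) (lam i x)) (P i x)) :
  (forall x, Omega x ->
     H x = \sum_(i < m) (lam i x / \tr (P i x)) *: P i x) /\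
  forall j : 'I_m,
  [/\ (* (A) *)
      Ck_on Omega 0 H ->
      (* (i) *)
      {within Omega, continuous (lam j)} /\
      (* (ii) *)
      (forall alpha C : R, 0 < alpha <= 1 ->
         holder_on frob Omega alpha C H ->
         holder_on Num.norm Omega alpha C (lam j)),
      (* (B) *)
      Ck_on Omega 1 H ->
      (* (i) *)
      (forall d : R, const_dim Omega (P j) d ->
         forall (x : 'cV[R]_n) (e : 'cV[R]_n), Omega x ->
         [/\ derivable (lam j) x e,
             'D_e (lam j) x *: P j x = P j x *m 'D_e H x *m P j x,
             'D_e (lam j) x = d^-1 * \tr (P j x *m 'D_e H x) &
             forall xi, unit_eigvec (P j x) xi ->
               'D_e (lam j) x = (xi^T *m 'D_e H x *m xi) 0 0 /\
               'D_e (lam j) x = (xi^T *m nabla xi H x *m e) 0 0]) /\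
      (* (ii) *)
      [<-> cond_a Omega (lam j) (P j); cond_b Omega (lam j) (P j);
           cond_c Omega (P j); cond_d Omega (P j)] /\
      (some_cond Omega (lam j) (P j) ->
       exists2 d : R, const_dim Omega (P j) d &
         forall x, Omega x ->
         [/\ differentiable (lam j) x,
             (exists2 M : R,
                is_maximum [set frob ('D_e H x) | e in usphere n] M &
                enorm (grad (lam j) x)^T <= (Num.sqrt d)^-1 * M),
             (forall xi, unit_eigvec (P j x) xi ->
                grad (lam j) x = xi^T *m nabla xi H x) &
             forall e : 'cV[R]_n,
               (grad (lam j) x *m e) 0 0 = 'D_e (lam j) x /\
               'D_e (lam j) x = d^-1 * \tr (P j x *m 'D_e H x)]) &
      (* (C) *)
      Ck_on Omega 2 H ->
      (* (i) *)
      (forall (a : 'cV[R]_n) (d : R), const_dim Omega (P j) d ->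
         (forall x, Omega x -> derivable (lam j) x a) /\
         forall (x : 'cV[R]_n) (b : 'cV[R]_n), Omega x ->
         [/\ derivable ('D_a (lam j)) x b,
             'D_b ('D_a (lam j)) x *: P j x =
               P j x *m ('D_b ('D_a H) x
                         + 'D_a H x *m Amx lam P j x *m 'D_b H x
                         + 'D_b H x *m Amx lam P j x *m 'D_a H x) *m P j x,
             'D_b ('D_a (lam j)) x =
               d^-1 * \tr (P j x *m ('D_b ('D_a H) x
                  + 2 *: ('D_a H x *m Amx lam P j x *m 'D_b H x))) &
             forall xi, unit_eigvec (P j x) xi ->
               'D_b ('D_a (lam j)) x =
                 (xi^T *m ('D_b ('D_a H) x
                   + 2 *: ('D_a H x *m Amx lam P j x *m 'D_b H x)) *m xi) 0 0 /\
               'D_b ('D_a (lam j)) x =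
                 (a^T *m (nabla xi (fun y => (nabla xi H y)^T) x
                   + 2 *: ((nabla xi H x)^T *m Amx lam P j x *m nabla xi H x))
                  *m b) 0 0]) /\
      (* (ii) *)
      (some_cond Omega (lam j) (P j) ->
       exists2 d : R, const_dim Omega (P j) d &
         forall x, Omega x ->
         [/\ differentiable (lam j) x,
             differentiable (grad (lam j)) x,
             (forall xi, unit_eigvec (P j x) xi ->
                hessian (lam j) x =
                  nabla xi (fun y => (nabla xi H y)^T) x
                  + 2 *: ((nabla xi H x)^T *m Amx lam P j x *m nabla xi H x)) &
             forall a b : 'cV[R]_n,
               (a^T *m hessian (lam j) x *m b) 0 0 = 'D_b ('D_a (lam j)) x /\
               'D_b ('D_a (lam j)) x =
                 d^-1 * \tr (P j x *m ('D_b ('D_a H) x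
                    + 2 *: ('D_a H x *m Amx lam P j x *m 'D_b H x)))])].

Proof.
have [_ oO _] := domOmega.
split=> [x Ox|j]; first exact: (spectral_decomposition Hsym lamE PE Ox).
(* Together with the immediate step from (a) to (b), these close the cycle of equivalences.
   Connectedness enters in the last one, to obtain a constant rank. *)
have first_order_conds : Ck_on Omega 1 H ->
    [/\ cond_b Omega (lam j) (P j) -> cond_c Omega (P j),
        cond_c Omega (P j) -> cond_d Omega (P j) &
        cond_d Omega (P j) -> cond_a Omega (lam j) (P j)].
  move=> [dH cdH]; split.
  - move=> [_ [d dimP]] x Ox.
    exact: (eigenprojection_has_deriv oO Hsym lamE PE dH dimP Ox).1.
  - move=> dP; apply/(within_openP _ oO) => x Ox.
    exact: differentiable_continuous (dP x Ox).
  - move=> cP; have [d dimP] := const_dim_of_continuous oO Hsym lamE PE domOmega cP.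
    have hl x (Ox : Omega x) := eigenvalue_has_deriv oO Hsym lamE PE dH dimP Ox.
    split; last by exists d.
    split=> [x Ox|e]; first exact: (hl x Ox).1.
    apply/(within_openP _ oO) => x Ox.
    have cPD : P j y *m 'D_e H y @[y --> x] --> P j x *m 'D_e H x.
      apply: (@cvg_mulmx R _ (nbhs x) _ m m m (P j) ('D_e H)).
        exact: (within_openP _ oO).1 cP x Ox.
      exact: (within_openP _ oO).1 (cdH e) x Ox.
    have cl : d^-1 * \tr (P j y *m 'D_e H y) @[y --> x] -->
        d^-1 * \tr (P j x *m 'D_e H x).
      exact: cvgMl_tmp (@cvg_mxtrace R _ (nbhs x) _ m _ _ cPD).
    rewrite /prop_for /continuous_at (hl x Ox).2; apply: (cvg_trans _ cl).
    have nO : \forall y \near x, Omega y := open_nbhs_nbhs (conj oO Ox).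
    by apply: (@near_eq_cvg _ _ (nbhs x)); apply: filterS nO => y Oy; rewrite (hl y Oy).2.
have some_cond_dim : Ck_on Omega 1 H -> some_cond Omega (lam j) (P j) ->
    exists d, const_dim Omega (P j) d.
  move=> /first_order_conds[_ cd da] [[_ //]|[_ //]|/cd/da[_ //]|/da[_ //]].
split.
- move=> /(within_openP _ oO) cH; split.
    apply/(within_openP _ oO) => x Ox.
    exact: (eigenvalue_continuous oO Hsym lamE Ox (cH x Ox)).
  by move=> alpha C _; exact: (eigenvalue_holder Hsym lamE).
- move=> H1; have [dH _] := H1; split; last split.
  + move=> d dimP x e Ox.
    have hl := eigenvalue_has_deriv oO Hsym lamE PE dH dimP Ox.
    split; [exact: has_deriv_derivable hl| |exact: hl.2|].
      exact: (derive_eigenvalue_mx oO Hsym lamE PE dH dimP Ox).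
    move=> xi uxi; split.
      exact: (derive_eigenvalue_quad oO Hsym lamE PE dH dimP Ox).
    exact: (derive_eigenvalue_nabla oO Hsym lamE PE dH dimP Ox).
  + have [bc cd da] := first_order_conds H1.
    tfae=> //.
    by move=> [[dl _] dimP].
  + move=> /(some_cond_dim H1)[d dimP]; exists d => // x Ox.
    have hl := eigenvalue_has_deriv oO Hsym lamE PE dH dimP Ox.
    split; [exact: hl.1| | |].
    * have cdH : continuous (fun e => frob ('d H x e)).
        move=> e; apply: (@cvg_frob R _ (nbhs e) (nbhs_filter e) m m ('d H x)).
        exact: (diff_continuous (dH x Ox)).
      have dHE : [set frob ('D_e H x) | e in usphere n] =
          [set frob ('d H x e) | e in usphere n].
        by apply: eq_imagel => e _; rewrite deriveE //; exact: dH.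
      have [M] := usphere_max n_gt0 cdH; rewrite -dHE => maxM; exists M => //.
      exact: (enorm_grad_eigenvalue_le oO Hsym lamE PE dH dimP Ox).
    * exact: (grad_eigenvalue_nabla oO Hsym lamE PE dH dimP Ox).
    * by move=> e; rewrite grad_mul ?hl.2 //; exact: hl.1.
- move=> [dH1 H2].
  have H1 : Ck_on Omega 1 H.
    split=> // e; apply/(within_openP _ oO) => x Ox.
    exact: differentiable_continuous ((H2 e).1 x Ox).
  have dH := dH1; have ddH a x (Ox : Omega x) := (H2 a).1 x Ox.
  split.
  + move=> a d dimP; split=> [x Ox|x b Ox].
      exact: has_deriv_derivable (eigenvalue_has_deriv oO Hsym lamE PE dH dimP Ox).
    have hl := derive_eigenvalue_has_deriv oO Hsym lamE PE dH ddH dimP Ox a.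
    split; [exact: has_deriv_derivable hl| |exact: hl.2|].
      exact: (derive2_eigenvalue_mx oO Hsym lamE PE dH ddH dimP Ox).
    move=> xi uxi.
    rewrite (quad_nabla2 oO Hsym j dH ddH Ox).
    have := derive2_eigenvalue_quad oO Hsym lamE PE dH ddH dimP Ox a b uxi.
    by split.
  + move=> /(some_cond_dim H1)[d dimP]; exists d => // x Ox.
    have [dg hE] := hessian_eigenvalue oO Hsym lamE PE dH ddH dimP Ox.
    split=> //.
    * exact: (eigenvalue_has_deriv oO Hsym lamE PE dH dimP Ox).1.
    * exact: (hessian_eigenvalue_nabla oO Hsym lamE PE dH ddH dimP Ox).
    * move=> a b; split; first exact: hE.
      exact: (derive_eigenvalue_has_deriv oO Hsym lamE PE dH ddH dimP Ox a).2.
Qed.
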